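(* The mapping $u\mapsto(u,(u^2+u_x^2)\,dx)$ is continuous from $H^1_{\rm per}$ into $(\mathcal{D},d_{\mathcal{D}})$. In other words, if $u_n\in H^1_{\rm per}$ converges in $H^1_{\rm per}$ to $u\in H^1_{\rm per}$, then $(u_n,(u_n^2+u_{n,x}^2)\,dx)$ converges to $(u,(u^2+u_x^2)\,dx)$ in $\mathcal{D}$, i.e. with respect to $d_{\mathcal{D}}$.
   Context: **Function spaces.** ''Periodic'' means 1-periodic on $\mathbb{R}$. $H^1_{\rm per}$ is the space of periodic $H^1_{\rm loc}(\mathbb{R})$ functions with norm $\big(\int_0^1(u^2+u_x^2)\,dx\big)^{1/2}$. $V_1=\{f\in W^{1,1}_{\rm loc}(\mathbb{R}): f(\xi+1)=f(\xi)+1\ \forall\xi\}$; $V=\{f\in W^{1,1}_{\rm loc}(\mathbb{R}):\exists\alpha\in\mathbb{R},\ f(\xi+1)=f(\xi)+\alpha\ \forall\xi\}$ with norm $\|f\|_V=\|f\|_{L^\infty([0,1])}+\|f_\xi\|_{L^1([0,1])}$; $W^{1,1}_{\rm per}$ is the space of periodic functions in $W^{1,1}_{\rm loc}(\mathbb{R})$ with the same norm; $L^1_{\rm per}$ is the space of periodic $L^1_{\rm loc}$ functions with norm $\|\cdot\|_{L^1([0,1])}$; $W^{1,\infty}_{\rm per}$ is the space of periodic functions in $W^{1,\infty}_{\rm loc}(\mathbb{R})$. $E=V\times W^{1,1}_{\rm per}\times L^1_{\rm per}$ with the sum norm. **Lagrangian set.** $\mathcal{F}$ is the set of $X=(y,U,\nu)\in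 E$ with $y\in V_1$; $y,U\in W^{1,\infty}_{\rm loc}(\mathbb{R})$; $\nu\in L^\infty$; $y_\xi\ge0$, $\nu\ge0$ and $y_\xi+\nu\ge c$ a.e. for some constant $c>0$; $y_\xi\nu=y_\xi^2U^2+U_\xi^2$ a.e. For $X\in\mathcal{F}$ write $h=\|\nu\|_{L^1([0,1])}$. **Relabeling.** $G$ is the group (under composition) of invertible $f\colon\mathbb{R}\to\mathbb{R}$ with $f\in W^{1,\infty}_{\rm loc}(\mathbb{R})$, $f(\xi+1)=f(\xi)+1$ for all $\xi$, and $f-\mathrm{id},f^{-1}-\mathrm{id}\in W^{1,\infty}_{\rm per}$. For $X=(y,U,\nu)\in\mathcal{F}$, $f\in G$: $X\bullet f=(y\circ f,U\circ f,(\nu\circ f)f_\xi)\in\mathcal{F}$. $\mathcal{F}_0=\{X\in\mathcal{F}: y_\xi+\nu=1+h \text{ a.e.}\}$ and $\mathcal{H}=\{(y,U,\nu)\in\mathcal{F}_0:\int_0^1y\,d\xi=0\}$. $\Pi_1\colon\mathcal{F}\to\mathcal{F}_0$, $\Pi_1(X)=X\bullet f^{-1}$ with $f(\xi)=\frac1{1+h}\big(y(\xi)+\int_0^\xi\nu\,d\eta\big)$; $\Pi_2\colon\mathcal{F}_0\to\mathcal{H}$, $\Pi_2(X)=X(\cdot-a)$ with $a=\int_0^1y\,d\xi$; $\Pi=\Pi_2\circ\Pi_1\colon\mathcal{F}\to\mathcal{H}$. **Lagrangian metric.** $J(X,Y)=\inf_{f,g\in G}\|X\bullet f-Y\bullet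 g\|_E$ for $X,Y\in\mathcal{F}$; $d(X,Y)=\inf\sum_{n=1}^NJ(X_{n-1},X_n)$ over all finite sequences $\{X_n\}_{n=0}^N$ in $\mathcal{F}$ with $X_0=X$, $X_N=Y$. **Eulerian set and metric.** $\mathcal{D}$ is the set of pairs $(u,\mu)$ with $u\in H^1_{\rm per}$ and $\mu$ a positive 1-periodic Radon measure on $\mathbb{R}$ whose absolutely continuous part is $\mu_{\rm ac}=(u^2+u_x^2)\,dx$. $L\colon\mathcal{D}\to\mathcal{H}$: given $(u,\mu)$, set $h=\mu([0,1))$, $F_\mu(x)=\mu([0,x))$ if $x>0$, $F_\mu(0)=0$, $F_\mu(x)=-\mu([x,0))$ if $x<0$, $y(\xi)=\sup\{y: F_\mu(y)+y<(1+h)\xi\}$, $\nu=(1+h)-y_\xi$, $U=u\circ y$; then $(y,U,\nu)\in\mathcal{F}_0$ and $L(u,\mu)=\Pi(y,U,\nu)$. $d_{\mathcal{D}}((u,\mu),(\tilde u,\tilde\mu))=d(L(u,\mu),L(\tilde u,\tilde\mu))$. *)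

(* Defs.v *)
From HB Require Import structures.
From mathcomp Require Import all_boot all_order all_algebra.
From mathcomp Require Import all_classical all_reals all_analysis.
From mathcomp Require Import measurable_realfun.

Set Implicit Arguments.
Unset Strict Implicit.
Unset Printing Implicit Defensive.

Import Order.TTheory GRing.Theory Num.Theory.
Import numFieldNormedType.Exports.

Local Open Scope classical_set_scope.
Local Open Scope ring_scope.

Section function_spaces.
Context {R : realType}.
Local Notation mu := (@lebesgue_measure R).
Implicit Types (f g phi : R -> R) (p : \bar R).

Definition Lloc p f := forall a b : R, f \_ `[a, b] \in Lfun mu p.

(* C^1 functions with compact support, the usual test functions for Sobolev
   spaces on an interval *)
Definition test_fun phi :=
  [/\ forall x, derivable phi x 1, continuous (derive1 phi)
    & exists M : R, forall x, M < `|x| -> phi x = 0].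

Definition weak_deriv f g :=
  Lloc 1%:E g /\
  forall phi, test_fun phi ->
    \int[mu]_x (f x * derive1 phi x) = - \int[mu]_x (g x * phi x).

(* A weak derivative is unique up to null sets; wderiv picks a representative.
   It is used only inside integrals, norms and almost-everywhere statements. *)
Definition wderiv f : R -> R := xget (cst 0) [set g | weak_deriv f g].

(* Elements of W^{1,p}_loc(R) are represented by their continuous
   representative, so that pointwise values and compositions make sense. *)
Definition W1loc p f :=
  [/\ continuous f, Lloc p f & exists2 g, weak_deriv f g & Lloc p g].

Definition periodic f := forall x, f (x + 1) = f x.

Definition W1per p f := W1loc p f /\ periodic f.

(* Elements of L^1 are represented by Borel functions, which need only be
   periodic almost everywhere. *)
Definition L1per f := Lloc 1%:E f /\ (\forall x \ae mu, f (x + 1) = f x).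

Definition inV f :=
  W1loc 1%:E f /\ exists alpha : R, forall x, f (x + 1) = f x + alpha.

Definition inV1 f := W1loc 1%:E f /\ forall x, f (x + 1) = f x + 1.

Definition norm01 p f : \bar R := Lnorm mu p (EFin \o (f \_ `[0, 1])).

Definition normV f : \bar R := (norm01 +oo f + norm01 1%:E (wderiv f))%E.

Definition H1norm f : R :=
  Num.sqrt (\int[mu]_(x in `[0, 1]) (f x ^+ 2 + wderiv f x ^+ 2)).

(* the integral from a to b, with its sign when b < a *)
Definition oriented_integral f (a b : R) : R :=
  if a <= b then \int[mu]_(x in `[a, b]) f x
  else - \int[mu]_(x in `[b, a]) f x.

End function_spaces.

Record H1per (R : realType) := MkH1per {
  H1fun :> R -> R ;
  H1funP : W1per 2%:E H1fun }.

Section lagrangian.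
Context {R : realType}.
Local Notation mu := (@lebesgue_measure R).

(* a triple (y, U, nu) *)
Record lagr := Lagr { ly : R -> R ; lU : R -> R ; lnu : R -> R }.

Implicit Types (X Y : lagr) (f g : R -> R).

Definition inE X := [/\ inV (ly X), W1per 1%:E (lU X) & L1per (lnu X)].

Definition normE X : \bar R :=
  (normV (ly X) + normV (lU X) + norm01 1%:E (lnu X))%E.

Definition lsub X Y : lagr :=
  Lagr (ly X \- ly Y) (lU X \- lU Y) (lnu X \- lnu Y).

Definition inF X : Prop :=
  let: Lagr y U nu := X in
  [/\ inE X, inV1 y, W1loc +oo%E y /\ W1loc +oo%E U, nu \in Lfun mu +oo%E
    & [/\ \forall x \ae mu, 0 <= wderiv y x,
          \forall x \ae mu, 0 <= nu x,
          exists2 c : R, 0 < c & \forall x \ae mu, c <= wderiv y x + nu x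
        & \forall x \ae mu,
            wderiv y x * nu x
            = wderiv y x ^+ 2 * U x ^+ 2 + wderiv U x ^+ 2]].

Definition lagr_h X : R := fine (norm01 1%:E (lnu X)).

Definition inverse f : R -> R := 'pinv_(fun=> 0) setT f.

Definition inG f :=
  [/\ bijective f, W1loc +oo%E f, forall x, f (x + 1) = f x + 1,
      W1per +oo%E (f \- id) & W1per +oo%E (inverse f \- id)].

Definition relabel X f : lagr :=
  Lagr (ly X \o f) (lU X \o f) ((lnu X \o f) \* wderiv f).

Definition Pi1 X : lagr :=
  let f := fun xi =>
    (1 + lagr_h X)^-1 * (ly X xi + oriented_integral (lnu X) 0 xi) in
  relabel X (inverse f).

Definition Pi2 X : lagr :=
  let a := \int[mu]_(xi in `[0, 1]) ly X xi in
  Lagr (fun xi => ly X (xi - a)) (fun xi => lU X (xi - a))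
       (fun xi => lnu X (xi - a)).

Definition Pi X : lagr := Pi2 (Pi1 X).

Definition J X Y : \bar R :=
  ereal_inf [set r | exists f g, [/\ inG f, inG g
    & r = normE (lsub (relabel X f) (relabel Y g))]].

Definition dF X Y : \bar R :=
  ereal_inf [set r | exists (N : nat) (S : nat -> lagr),
    [/\ forall n, (n <= N)%N -> inF (S n), S 0%N = X, S N = Y
      & r = (\sum_(n < N) J (S n) (S n.+1))%E]].

End lagrangian.
Arguments lagr : clear implicits.

Section eulerian.
Context {R : realType}.
Local Notation leb := (@lebesgue_measure R).
Local Notation measureR := {measure set (measurableTypeR R) -> \bar R}.
Implicit Types (m nu : measureR) (u : H1per R).

Definition singular m := exists N : set (measurableTypeR R),
  [/\ measurable N, leb N = 0%E & m (~` N) = 0%E].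

(* nu is the absolutely continuous part in the Lebesgue decomposition of m *)
Definition ac_part m nu :=
  nu `<< leb /\
  exists2 s : measureR, singular s
    & forall A, measurable A -> m A = (nu A + s A)%E.

(* on the line, Borel measures that are finite on compact sets are Radon *)
Definition radon m := forall K : set R, compact K -> (m K < +oo)%E.

Definition periodic_measure m :=
  forall A : set (measurableTypeR R), measurable A ->
    m [set x + 1 | x in A] = m A.

Definition energy u (A : set (measurableTypeR R)) : \bar R :=
  (\int[leb]_(x in A) (u x ^+ 2 + wderiv u x ^+ 2)%:E)%E.

Lemma measurable_Lloc p (f : R -> R) : Lloc p f -> measurable_fun setT f.
Proof.
move=> Lf; pose F n := `[- n%:R, n%:R]%classic : set R.
have -> : [set: R] = \bigcup_n F n.
  apply/seteqP; split => // x _; exists (Num.truncn `|x|).+1 => //=.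
  by rewrite /F /= in_itv/= -ler_norml ltW// truncnS_gt.
apply/measurable_fun_bigcup => [n|n]; first exact: measurable_itv.
have /sub_Lfun_mfun/set_mem mf := Lf (- n%:R) n%:R.
apply: (@eq_measurable_fun _ _ _ _ (F n) (f \_ `[- n%:R, n%:R])).
  by move=> x xF; rewrite patchE xF.
exact: measurable_funTS.
Qed.

Lemma measurable_wderiv (f : R -> R) : measurable_fun setT (wderiv f).
Proof.
rewrite /wderiv; case: xgetP => [g _ [/measurable_Lloc]//|_].
exact: measurable_cst.
Qed.

Lemma energy0 u : energy u set0 = 0%E. Proof. exact: integral_set0. Qed.

Lemma energy_ge0 u A : (0 <= energy u A)%E.
Proof. by apply: integral_ge0 => x _; rewrite lee_fin addr_ge0// sqr_ge0. Qed.

Lemma energy_sigma_additive u : semi_sigma_additive (energy u).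
Proof.
apply: semi_sigma_additive_nng_induced => [|x]; last first.
  by rewrite lee_fin addr_ge0// sqr_ge0.
have [[_ /measurable_Lloc mf _] _] := H1funP u.
apply/measurable_EFinP; apply: measurable_funD; apply: measurable_funX => //.
exact: measurable_wderiv.
Qed.

(* the measure (u^2 + u_x^2) dx *)
HB.instance Definition _ u := isMeasure.Build _ _ _ (energy u)
  (energy0 u) (energy_ge0 u) (@energy_sigma_additive u).

Definition inD u m :=
  [/\ periodic_measure m, radon m & ac_part m (energy u)].

Definition cumul m (x : R) : R :=
  if 0 < x then fine (m `[0, x[%classic)
  else if x < 0 then - fine (m `[x, 0[%classic) else 0.

Definition L u m : lagr R :=
  let h := fine (m `[0, 1[%classic) in
  let y := fun xi : R => sup [set z | cumul m z + z < (1 + h) * xi] in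
  Pi (Lagr y (u \o y) (fun xi => 1 + h - wderiv y xi)).

Definition dD (P Q : H1per R * measureR) : \bar R :=
  dF (L P.1 P.2) (L Q.1 Q.2).

Definition embed u : H1per R * measureR := (u, energy u : measureR).

End eulerian.

(* Main.v *)
(* With G(x) = x + int_0^x (u^2 + u_x^2), the first coordinate y of L(u) is the
   inverse of G/(1 + h), and the substitution x = y(xi) gives
   y_xi = (1 + h)/(1 + e) o y and U_xi = (1 + h) (u_x/(1 + e)) o y, where
   e = u^2 + u_x^2. Undoing the shift Pi2 by translations, which belong to G,
   bounds the distance by the E-norm of the difference of the two triples. The
   sup norms are controlled by int |e_v - e_u|. For the L^1 norms of the
   derivatives, k o y_u (with k = 1/(1 + e) or u_x/(1 + e)) is approximated by a
   continuous function, and k_v o y_v is compared with it after substituting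
   x = y_v(xi), where the density (1 + e_v)/(1 + h_v) cancels the denominator
   of k_v. *)
Require Import Defs.
From HB Require Import structures.
From mathcomp Require Import all_boot all_order all_algebra.
From mathcomp Require Import all_classical all_reals all_analysis.
From mathcomp Require Import measurable_realfun ess_sup_inf ring lra.
Import Order.TTheory GRing.Theory Num.Theory.
Import numFieldNormedType.Exports.

Set Implicit Arguments.
Unset Strict Implicit.
Unset Printing Implicit Defensive.

Local Open Scope classical_set_scope.
Local Open Scope ring_scope.

(** * Locally integrable functions and their primitives *)

Section locally_integrable_functions.
Context {R : realType}.
Local Notation mu := (@lebesgue_measure R).
Implicit Types (f g : R -> R) (a b c : R).

(** Every derivative in the definitions is [wderiv], an arbitrary pick among weak derivatives, so no
    pointwise formula for it is available. The proof therefore runs on [primitive F g], the integral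
    form of F' = g; for continuous F it is equivalent to g being a weak derivative of F, and each
    formula for [wderiv] becomes an almost everywhere identity between two densities of one
    function. This form also survives composition with y, whose inverse is merely absolutely
    continuous: the substitution rule comes from uniqueness of Lebesgue measure, not from
    differentiating y. The obstacle in the limit is that k_v o y_v changes both in k_v and in y_v,
    while closeness in H^1 controls e_v - e_u only in L^1, with no pointwise or uniform bound on
    e_v. Two facts make up for this: both choices of k are bounded by 1, and k (1 + e) is 1 or u_x,
    which depends on u continuously in L^1 over a period. *)

Lemma Lloc1P f : Lloc 1%:E f <->
  measurable_fun setT f /\ forall a b, mu.-integrable `[a, b] (EFin \o f).
Proof.
split=> [Lf|[mf intf] a b].
  split=> [|a b]; first exact: measurable_Lloc Lf.
  have /Lfun1_integrable := Lf a b.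
  by move=> h; apply/integrable_mkcond => //; rewrite restrict_EFin.
apply/Lfun1_integrable; rewrite -restrict_EFin.
by move: (intf a b) => /integrable_mkcond; apply.
Qed.

Lemma Lloc1_measurable f : Lloc 1%:E f -> measurable_fun setT f.
Proof. by move=> /Lloc1P[]. Qed.

Lemma Lloc1_integrable f (i : interval R) a b : Lloc 1%:E f ->
  [set` i] `<=` `[a, b]%classic -> mu.-integrable [set` i] (EFin \o f).
Proof. by move=> /Lloc1P[_ /(_ a b)] + iab; apply: integrableS. Qed.

Lemma Lloc1_itvcc f a b : Lloc 1%:E f -> mu.-integrable `[a, b] (EFin \o f).
Proof. by move=> /Lloc1P[_]. Qed.

Lemma Lloc1_le f g : measurable_fun setT f -> (forall x, `|f x| <= g x) ->
  Lloc 1%:E g -> Lloc 1%:E f.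
Proof.
move=> mf fg /Lloc1P[mg intg]; apply/Lloc1P; split=> // a b.
apply: (le_integrable _ _ _ (intg a b)) => //.
  by apply/measurable_EFinP; exact: measurable_funTS.
by move=> x _ /=; rewrite lee_fin (le_trans (fg x))// ler_norm.
Qed.

Lemma Lloc1D f g : Lloc 1%:E f -> Lloc 1%:E g -> Lloc 1%:E (f \+ g).
Proof.
move=> /Lloc1P[mf If] /Lloc1P[mg Ig]; apply/Lloc1P; split.
  exact: measurable_funD.
move=> a b.
by apply: (integrableD _ (If a b) (Ig a b)).
Qed.

Lemma Lloc1Z f c : Lloc 1%:E f -> Lloc 1%:E (fun x => c * f x).
Proof.
move=> /Lloc1P[mf If]; apply/Lloc1P; split; first exact: measurable_funM.
by move=> a b; apply: (integrableZl _ c (If a b)).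
Qed.

Lemma Lloc1B f g : Lloc 1%:E f -> Lloc 1%:E g -> Lloc 1%:E (f \- g).
Proof.
move=> Lf Lg; have -> : f \- g = f \+ (fun x => -1 * g x).
  by apply/funext => x /=; rewrite mulN1r.
exact/Lloc1D/Lloc1Z.
Qed.

Lemma Lloc1_norm f : Lloc 1%:E f -> Lloc 1%:E (fun x => `|f x|).
Proof.
move=> /Lloc1P[mf If]; apply/Lloc1P; split; first exact: measurableT_comp.
by move=> a b; exact: integrable_norm.
Qed.

Lemma Lloc1_cst c : Lloc 1%:E (fun=> c : R).
Proof.
apply/Lloc1P; split=> // a b.
apply: measurable_bounded_integrable => //.
  by rewrite /= lebesgue_measure_itv; case: ifP; rewrite ?ltry// -EFinB ltry.
exists `|c|; split=> // M /ltW cM x _ /=.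
exact: cM.
Qed.

Lemma Lloc1_continuous f : continuous f -> Lloc 1%:E f.
Proof.
move=> cf; apply/Lloc1P; split; first exact: continuous_measurable_fun.
move=> a b; apply: continuous_compact_integrable; first exact: segment_compact.
exact: continuous_subspaceT.
Qed.


Lemma Lloc2_sqr f : Lloc 2%:E f -> Lloc 1%:E (fun x => f x ^+ 2).
Proof.
move=> Lf; apply/Lloc1P; split.
  by apply: measurable_funX; exact: measurable_Lloc Lf.
move=> a b; have /Lfun2_integrable_sqr := Lf a b.
move=> intf; apply/integrable_mkcond => //; rewrite restrict_EFin.
apply: eq_integrable intf => // x _ /=; rewrite !patchE; case: ifPn => //= _.
by rewrite expr0n.
Qed.

End locally_integrable_functions.

(** * Integral primitives and the uniqueness of their density *)

Section primitives.
Context {R : realType}.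
Local Notation mu := (@lebesgue_measure R).
Implicit Types (f g F : R -> R) (a b c : R).

(** Absolute continuity of F with derivative g, in integral form. The restriction to [a <= b] is
    needed because the integral over a set carries no orientation. *)
Definition primitive F g := Lloc 1%:E g /\
  forall a b, a <= b -> \int[mu]_(x in `[a, b]) g x = F b - F a.

Lemma Rintegral_itv_split g a b c : Lloc 1%:E g -> a <= b -> b <= c ->
  \int[mu]_(x in `[a, c]) g x =
  \int[mu]_(x in `[a, b]) g x + \int[mu]_(x in `[b, c]) g x.
Proof.
move=> Lg ab bc; have := @Rintegral_itvB R g (BLeft a) (BRight c) b.
rewrite !bnd_simp => /(_ _ ab bc) H.
rewrite -[X in _ + X]Rintegral_itv_obnd_cbnd.
  by rewrite -H ?subrKC//; exact: Lloc1_itvcc.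
by apply: (@Lloc1_integrable _ _ _ b c) => //; exact: subset_itv_oc_cc.
Qed.

Lemma primitive_oriented_integral g :
  Lloc 1%:E g -> primitive (oriented_integral g 0) g.
Proof.
move=> Lg; split=> // a b ab; rewrite /oriented_integral.
have [a0|a0] := leP 0 a.
  rewrite (le_trans a0 ab) (Rintegral_itv_split Lg a0 ab).
  by rewrite addrC addKr.
have [b0|b0] := leP 0 b.
  by rewrite (Rintegral_itv_split Lg (ltW a0) b0) opprK addrC.
by rewrite (Rintegral_itv_split Lg ab (ltW b0)) opprK addrC addrK.
Qed.

Lemma primitive_continuous F g : primitive F g -> continuous F.
Proof.
move=> [Lg Fg] x; set a := x - 1; set b := x + 1.
have ab : a < b by rewrite /a /b; lra.
have := @parameterized_integral_continuous R a b g (ltW ab).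
move=> /(_ (Lloc1_itvcc _ _ Lg)).
move=> /(continuous_within_itvP _ ab)[+ _ _] => /(_ x).
have -> : (x \in `]a, b[) by rewrite in_itv/= /a /b; lra.
move=> /(_ isT) cx.
have -> : F = fun y => F y - F a + F a by apply/funext => y; rewrite subrK.
apply: cvgD; last exact: cvg_cst.
have -> : F x - F a = parameterized_integral mu a x g.
  by rewrite /parameterized_integral Fg// /a; lra.
apply: cvg_trans cx; apply: near_eq_cvg.
near=> y; rewrite /parameterized_integral Fg//.
near: y; exists 1 => //= y /=; rewrite ltr_distl => /andP[xy yx].
rewrite /a; lra.
Unshelve. all: by end_near. Qed.

Lemma Lloc1_locally_integrable g : Lloc 1%:E g -> locally_integrable setT g.
Proof.
move=> Lg; split; [exact: Lloc1_measurable|exact: openT|].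
move=> K _ cK; have [M [_ KM]] := compact_bounded cK.
have KI : K `<=` `[- (M + 1), M + 1]%classic.
  by move=> x Kx; rewrite /= in_itv/= -ler_norml (KM (M + 1)) // ltrDl.
have /integrableP[_] := Lloc1_integrable Lg (@subset_refl _ `[- (M + 1), M + 1]%classic).
apply: le_lt_trans; apply: ge0_subset_integral => //.
  exact: compact_measurable.
apply: measurable_funTS; do 2 apply: measurableT_comp => //.
exact: Lloc1_measurable.
Qed.

(** By Lebesgue differentiation both densities are almost everywhere the derivative of the same
    function. Differentiation is available only to the right of a fixed base point [-n], hence the
    countable intersection over n. *)
Lemma primitive_ae_unique F g1 g2 : primitive F g1 -> primitive F g2 ->
  \forall x \ae mu, g1 x = g2 x.
Proof.
move=> [Lg1 F1] [Lg2 F2].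
have ae_deriv (g : R -> R) (n : nat) : Lloc 1%:E g -> {ae mu, forall x, - n%:R < x ->
    derive1 (fun y => \int[mu]_(t in `[- n%:R, y]) g t) x = g x}.
  move=> Lg.
  have := @FTC1 R g (BLeft (- n%:R)) _ (Lloc1_locally_integrable Lg).
  move=> /(_ (fun y => Lloc1_integrable Lg (@subset_refl _ _))).
  apply: filterS; first exact: (ae_filter_ringOfSetsType mu).
  move=> x h nx; by apply h; rewrite /= lte_fin.
have H : {ae mu, forall x, forall n : nat, - n%:R < x -> g1 x = g2 x}.
  apply/ae_foralln => n.
  move: (ae_deriv g1 n Lg1) (ae_deriv g2 n Lg2); apply: filterS2; first exact: (ae_filter_ringOfSetsType mu).
  move=> x h1 h2 nx.
  rewrite -(h1 nx) -(h2 nx); congr (derive1 _ x); apply/funext => y.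
  have [ny|yn] := leP (- n%:R) y; first by rewrite F1// F2.
  by rewrite set_itv_ge ?Rintegral_set0// bnd_simp -ltNge.
move: H; apply: filterS; first exact: (ae_filter_ringOfSetsType mu).
move=> x /(_ (Num.truncn `|x|).+1); apply.
by rewrite ltrNl (le_lt_trans (ler_norm _))// normrN truncnS_gt.
Qed.

End primitives.

(** * Test functions, supports, approximation in L^1 *)

Section test_functions.
Context {R : realType}.
Local Notation mu := (@lebesgue_measure R).
Implicit Types (f g F phi : R -> R) (a b c : R).

Lemma Lloc1M f g : measurable_fun setT f ->
  (forall a b, exists M, forall x, x \in `[a, b] -> `|f x| <= M) ->
  Lloc 1%:E g -> Lloc 1%:E (fun x => f x * g x).
Proof.
move=> mf bf Lg; apply/Lloc1P; split.
  by apply: measurable_funM => //; exact: Lloc1_measurable.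
move=> a b; have [M fM] := bf a b.
rewrite (_ : EFin \o _ = (EFin \o f) \* (EFin \o g))%E; last by apply/funext.
apply: integrableMr => //; [exact: measurable_funTS| |exact: Lloc1_itvcc].
exists M; split; first exact: num_real.
by move=> N /ltW MN x /= xab; rewrite (le_trans (fM _ xab)).
Qed.

Lemma continuous_bounded_itvcc f a b : continuous f ->
  exists M, forall x, x \in `[a, b] -> `|f x| <= M.
Proof.
move=> cf; have : compact (f @` `[a, b]).
  apply: continuous_compact; last exact: segment_compact.
  exact: continuous_subspaceT.
move=> /compact_bounded[M [_ fM]]; exists (M + 1) => x xab.
by apply: (fM (M + 1)); [rewrite ltrDl|exists x].
Qed.

Lemma Lloc1_continuousM f g : continuous f -> Lloc 1%:E g ->
  Lloc 1%:E (fun x => f x * g x).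
Proof.
move=> cf; apply: Lloc1M; first exact: continuous_measurable_fun.
by move=> a b; exact: continuous_bounded_itvcc.
Qed.

Lemma test_fun_continuous phi : test_fun phi -> continuous phi.
Proof.
by move=> [dphi _ _] x; apply/differentiable_continuous/derivable1_diffP.
Qed.

Lemma test_fun_support phi : test_fun phi -> exists2 K, 0 < K &
  forall x, K <= `|x| -> phi x = 0 /\ derive1 phi x = 0.
Proof.
(* The absolute value makes the bound positive even if M is negative. The extra 1 puts x strictly
   inside the open set [M < |x|], where phi vanishes identically, so that its derivative vanishes as
   well. *)
move=> [dphi _ [M phi0]]; exists (`|M| + 1) => [|x Kx]; first by rewrite ltr_wpDl.
have Mx : M < `|x|.
  by rewrite (lt_le_trans _ Kx)// (le_lt_trans (ler_norm _))// ltrDl.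
split; first exact: phi0.
rewrite derive1E -(derive_cst (0 : R) x 1); apply: near_eq_derive => //.
near=> y; apply: phi0; near: y.
have := @norm_continuous _ R x; move/cvgr_gt; exact.
Unshelve. all: by end_near. Qed.

Lemma Rintegral_support f a b : (forall x, x \notin `[a, b] -> f x = 0) ->
  \int[mu]_x f x = \int[mu]_(x in `[a, b]) f x.
Proof.
move=> f0; rewrite [RHS]Rintegral_mkcond; apply: eq_Rintegral => x _.
rewrite patchE; case: ifPn => // xab; rewrite f0//.
by apply: contra xab => xab; rewrite inE.
Qed.

Lemma approximation_continuous g a b (e : R) : 0 < e -> Lloc 1%:E g ->
  exists2 k : R -> R, continuous k &
    \int[mu]_(x in `[a, b]) `|g x - k x| < e.
Proof.
move=> e0 Lg.
have fab : (mu `[a, b]%classic < +oo)%E.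
  by rewrite /= lebesgue_measure_itv; case: ifP; rewrite ?ltry// -EFinB ltry.
have [|k [ck Ik]] :=
  @approximation_continuous_integrable _ `[a, b]%classic g _ fab (Lloc1_itvcc a b Lg).
  by [].
move=> /fine_fcvg/cvgrPdist_lt/(_ _ e0)[N _ /(_ N (leqnn N))]/=.
rewrite sub0r normrN => h; exists (k N) => //.
by rewrite (le_lt_trans (ler_norm _)).
Qed.

End test_functions.

(** * The density of a primitive is a weak derivative *)

Section weak_derivative_of_primitive.
Context {R : realType}.
Local Notation mu := (@lebesgue_measure R).
Implicit Types (f g F phi : R -> R) (a b c : R).

Lemma le_normr_Rintegral_itvcc f g a b : Lloc 1%:E f -> Lloc 1%:E g ->
  (forall x, x \in `[a, b] -> `|f x| <= g x) ->
  `|\int[mu]_(x in `[a, b]) f x| <= \int[mu]_(x in `[a, b]) g x.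
Proof.
move=> Lf Lg fg.
apply: (le_trans (le_normr_Rintegral _ (Lloc1_itvcc a b Lf))) => //.
apply: le_Rintegral => //; [|exact: Lloc1_itvcc].
exact/Lloc1_itvcc/Lloc1_norm.
Qed.

Lemma Rintegral_cst_itvcc c a b : a <= b ->
  \int[mu]_(x in `[a, b]) c = c * (b - a).
Proof.
move=> ab; rewrite Rintegral_cst//= lebesgue_measure_itv/= lte_fin.
by move: ab; rewrite le_eqVlt => /predU1P[->|->//]; rewrite ltxx subrr.
Qed.

Lemma RintegralD_itvcc f g a b : Lloc 1%:E f -> Lloc 1%:E g ->
  \int[mu]_(x in `[a, b]) (f x + g x) =
  \int[mu]_(x in `[a, b]) f x + \int[mu]_(x in `[a, b]) g x.
Proof. by move=> Lf Lg; rewrite RintegralD//; exact: Lloc1_itvcc. Qed.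

Lemma RintegralB_itvcc f g a b : Lloc 1%:E f -> Lloc 1%:E g ->
  \int[mu]_(x in `[a, b]) (f x - g x) =
  \int[mu]_(x in `[a, b]) f x - \int[mu]_(x in `[a, b]) g x.
Proof. by move=> Lf Lg; rewrite RintegralB//; exact: Lloc1_itvcc. Qed.

Lemma RintegralZl_itvcc f c a b : Lloc 1%:E f ->
  \int[mu]_(x in `[a, b]) (c * f x) = c * \int[mu]_(x in `[a, b]) f x.
Proof. by move=> Lf; rewrite RintegralZl//; exact: Lloc1_itvcc. Qed.

Lemma Rintegral_itvcc_subset f a b c d : Lloc 1%:E f -> (forall x, 0 <= f x) ->
  a <= c -> d <= b ->
  \int[mu]_(x in `[c, d]) f x <= \int[mu]_(x in `[a, b]) f x.
Proof.
move=> Lf f0 ac db; have [cd|dc] := leP c d; last first.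
  rewrite set_itv_ge ?Rintegral_set0; first exact: Rintegral_ge0.
  by rewrite bnd_simp -ltNge.
rewrite (@Rintegral_itv_split _ _ a c b)//; last exact: le_trans cd db.
rewrite (@Rintegral_itv_split _ _ c d b)//.
have := @Rintegral_ge0 _ _ _ mu `[a, c]%classic f (fun x _ => f0 x).
have := @Rintegral_ge0 _ _ _ mu `[d, b]%classic f (fun x _ => f0 x).
lra.
Qed.

Lemma primitiveB F1 F2 g1 g2 : primitive F1 g1 -> primitive F2 g2 ->
  primitive (F1 \- F2) (g1 \- g2).
Proof.
move=> [L1 P1] [L2 P2]; split=> [|a b ab]; first exact: Lloc1B.
by rewrite RintegralB_itvcc// P1// P2//=; ring.
Qed.

Lemma primitiveD F1 F2 g1 g2 : primitive F1 g1 -> primitive F2 g2 ->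
  primitive (F1 \+ F2) (g1 \+ g2).
Proof.
move=> [L1 P1] [L2 P2]; split=> [|a b ab]; first exact: Lloc1D.
by rewrite RintegralD_itvcc// P1// P2//=; ring.
Qed.

Lemma primitiveZ F g c : primitive F g ->
  primitive (fun x => c * F x) (fun x => c * g x).
Proof.
move=> [Lg Fg]; split=> [|a b ab]; first exact: Lloc1Z.
by rewrite RintegralZl_itvcc// Fg// mulrBr.
Qed.

Lemma primitive_cst c : primitive (fun=> c) (fun=> 0).
Proof.
split=> [|a b ab]; first exact: Lloc1_cst.
by rewrite Rintegral_cst_itvcc// mul0r subrr.
Qed.

Lemma primitive_id : primitive (@id R) (fun=> 1).
Proof.
split=> [|a b ab]; first exact: Lloc1_cst.
by rewrite Rintegral_cst_itvcc// mul1r.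
Qed.

Lemma primitive_continuous_derive F k x : primitive F k -> continuous k ->
  derivable F x 1 /\ derive1 F x = k x.
Proof.
move=> [Lk Fk] ck; have xx : x < x + 1 by rewrite ltrDl.
have x1x : x - 1 < x by rewrite ltrBlDr ltrDl.
have [dF Fx] := continuous_FTC1_closed xx (Lloc1_itvcc _ _ Lk) x1x (ck x).
have near_eq : \forall y \near x,
    \int[mu]_(t in `[x - 1, y]) k t + F (x - 1) = F y.
  near=> y; rewrite Fk ?subrK//; near: y; exists 1 => //= y /=.
  by rewrite ltr_distl => /andP[xy yx]; lra.
split.
  apply: (near_eq_derivable near_eq).
  by apply: (derivableD dF); exact: derivable_cst.
rewrite -Fx !derive1E -(near_eq_derive _ near_eq).
by rewrite (deriveD dF (derivable_cst _ _ _)) derive_cst addr0.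
Unshelve. all: by end_near. Qed.

Lemma integration_by_parts_primitive F k phi a b : a < b ->
  primitive F k -> continuous k -> test_fun phi ->
  \int[mu]_(x in `[a, b]) (F x * derive1 phi x) =
  F b * phi b - F a * phi a - \int[mu]_(x in `[a, b]) (k x * phi x).
Proof.
move=> ab Fk ck tphi; have [dphi cphi' _] := tphi.
have cF := primitive_continuous Fk; have cphi := test_fun_continuous tphi.
apply: (Rintegration_by_parts ab).
- exact: continuous_subspaceT.
- split; first by move=> x _; have [] := primitive_continuous_derive x Fk ck.
    exact/cvg_at_right_filter/cF.
  exact/cvg_at_left_filter/cF.
- by move=> x _; have [] := primitive_continuous_derive x Fk ck.
- exact: continuous_subspaceT.
- split; first by move=> x _; exact: dphi.
    exact/cvg_at_right_filter/cphi.
  exact/cvg_at_left_filter/cphi.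
- by move=> x _.
Qed.

(** For a continuous density this is classical integration by parts. A general g is replaced by a
    continuous k close to it in L^1 on the support of phi; the primitives of g and k are then
    uniformly close there. *)
Lemma primitive_weak_deriv F g : primitive F g -> weak_deriv F g.
Proof.
move=> Fg; split=> [|phi tphi]; first by case: Fg.
have [K K0 phiK] := test_fun_support tphi.
have [dphi cphi' _] := tphi; have cphi := test_fun_continuous tphi.
have cF := primitive_continuous Fg; have Lg := Fg.1.
have phi0 x : x \notin `[-K, K] -> phi x = 0 /\ derive1 phi x = 0.
  rewrite in_itv/= -ler_norml -ltNge => /ltW; exact: phiK.
rewrite (@Rintegral_support _ _ (- K) K); last first.
  by move=> x /phi0[_ ->]; rewrite mulr0.
rewrite (@Rintegral_support _ _ (- K) K); last first.
  by move=> x /phi0[-> _]; rewrite mulr0.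
have KK : -K < K by lra.
have [C1 phiC1] := continuous_bounded_itvcc (- K) K cphi.
have [C2 phiC2] := continuous_bounded_itvcc (- K) K cphi'.
pose C := `|C1| + `|C2|.
have phiC x : x \in `[-K, K] -> `|phi x| <= C /\ `|derive1 phi x| <= C.
  move=> xK; rewrite /C; have := phiC1 _ xK; have := phiC2 _ xK.
  have := ler_norm C1; have := ler_norm C2.
  by have := normr_ge0 C1; have := normr_ge0 C2; split; lra.
have C0 : 0 <= C by rewrite addr_ge0.
apply/eqP; rewrite -subr_eq0 opprK -normr_le0; apply/ler_addgt0Pr => e e0.
rewrite add0r.
(* If g and k differ by d in L^1, the error is at most [d * C * (2 * K)] from the primitives and
   [C * d] from the densities; the 1 only keeps the divisor positive. *)
have C21 : 0 < C * (2 * K) + C + 1 by rewrite ltr_wpDl// addr_ge0// !mulr_ge0// ltW.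
have [k ck gk] := approximation_continuous (- K) K (divr_gt0 e0 C21) Lg.
set d := e / _ in gk.
have Lk := Lloc1_continuous ck.
(* The primitive of k that agrees with F at [-K], so that [F - Fk] is the integral of [g - k] from
   there. *)
pose Fk x := F (- K) + oriented_integral k 0 x - oriented_integral k 0 (- K).
have Pk : primitive Fk k.
  split=> // a b ab; rewrite (primitive_oriented_integral Lk).2// /Fk; ring.
have cFk := primitive_continuous Pk.
have := integration_by_parts_primitive KK Pk ck tphi.
have [->_] := phiK K ltac:(by rewrite gtr0_norm).
have [-> _] := phiK (- K) ltac:(by rewrite normrN gtr0_norm).
rewrite !mulr0 subrr sub0r => /eqP; rewrite -subr_eq0 opprK => /eqP Fk0.
rewrite -[X in `|X|]subr0 -{1}Fk0.
have LFphi := Lloc1_continuousM cF (Lloc1_continuous cphi').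
have LFkphi := Lloc1_continuousM cFk (Lloc1_continuous cphi').
have Lgphi : Lloc 1%:E (fun x => g x * phi x).
  have := Lloc1_continuousM cphi Lg; congr (Lloc _ _).
  by apply/funext => x; rewrite mulrC.
have Lkphi := Lloc1_continuousM ck (Lloc1_continuous cphi).
rewrite -!RintegralD_itvcc// -RintegralB_itvcc//; try exact: Lloc1D.
have [_ Pgk] := primitiveB Fg Pk.
have Fd x : x \in `[-K, K] -> `|F x - Fk x| <= d.
  rewrite in_itv/= => /andP[Kx xK].
  have -> : F x - Fk x = \int[mu]_(x in `[- K, x]) (g x - k x).
    by rewrite Pgk//= /Fk; ring.
  apply: (le_trans _ (ltW gk)).
  have Lgk : Lloc 1%:E (fun x => `|g x - k x|) by apply/Lloc1_norm/Lloc1B.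
  apply: le_trans (le_normr_Rintegral_itvcc _ Lgk _) _ => //.
    exact: Lloc1B.
  exact: Rintegral_itvcc_subset.
have Lgk : Lloc 1%:E (fun x => C * `|g x - k x|) by apply/Lloc1Z/Lloc1_norm/Lloc1B.
apply: (le_trans (@le_normr_Rintegral_itvcc _ (fun x => d * C + C * `|g x - k x|) _ _ _ _ _)).
- by apply: Lloc1B; exact: Lloc1D.
- by apply: Lloc1D => //; exact: Lloc1_cst.
- move=> x xK; have [p1 p2] := phiC _ xK.
  have -> : F x * derive1 phi x + g x * phi x - (Fk x * derive1 phi x + k x * phi x)
     = (F x - Fk x) * derive1 phi x + phi x * (g x - k x) by ring.
  rewrite (le_trans (ler_normD _ _))// !normrM lerD// ler_pM//.
  exact: Fd.
rewrite RintegralD_itvcc//; last exact: Lloc1_cst.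
rewrite Rintegral_cst_itvcc ?(ltW KK)// RintegralZl_itvcc//; last exact/Lloc1_norm/Lloc1B.
have -> : e = d * (C * (2 * K) + C + 1) by rewrite /d divfK// gt_eqF.
have d0 : 0 < d by rewrite divr_gt0.
have : C * \int[mu]_(x in `[(- K), K]) `|g x - k x| <= C * d by rewrite ler_wpM2l// ltW.
nra.
Qed.

End weak_derivative_of_primitive.

(** * A piecewise quadratic C^1 step *)

Section smooth_step.
Context {R : realType}.
Local Notation mu := (@lebesgue_measure R).
Implicit Types (f g F phi : R -> R) (a b c d x : R).

(** Test functions are only asked to be C^1, so squares of positive parts are smooth enough to build
    them. *)
Definition pospart x : R := Num.max 0 x.

Lemma pospartP x : (0 <= x /\ pospart x = x) \/ (x <= 0 /\ pospart x = 0).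
Proof.
rewrite /pospart; have [x0|x0] := leP 0 x; [left|right; split=> //]; last exact: ltW.
by [].
Qed.

Lemma is_derive_pospart_sqr x :
  is_derive x 1 (fun y => pospart y ^+ 2) (2 * pospart x).
Proof.
(* The first-order remainder is at most h^2 on either side of the kink and across it, so the
   difference quotient is off by at most |h|. *)
have H (h : R) : `|pospart (h + x) ^+ 2 - pospart x ^+ 2 - 2 * pospart x * h| <= h ^+ 2.
  rewrite ler_norml.
  by case: (pospartP x) => -[? ->]; case: (pospartP (h + x)) => -[? ->];
    apply/andP; split; nra.
have dlim : h^-1 *: (pospart (h *: 1 + x) ^+ 2 - pospart x ^+ 2) @[h --> 0^'] -->
    2 * pospart x.
  apply/cvgrPdist_lt => e e0; near=> h.
  have h0 : h != 0 by near: h; exact: nbhs_dnbhs_neq.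
  rewrite [h *: _]mulr1 distrC.
  have -> : h^-1 *: (pospart (h + x) ^+ 2 - pospart x ^+ 2) - 2 * pospart x =
      h^-1 * (pospart (h + x) ^+ 2 - pospart x ^+ 2 - 2 * pospart x * h).
    rewrite mulrBr; congr (_ - _); by field.
  rewrite normrM normfV ltr_pdivrMl ?normr_gt0// (le_lt_trans (H h))//.
  rewrite -(real_normK (num_real h)) expr2 ltr_pM2l ?normr_gt0//.
  near: h; exists e => //= h /=; by rewrite sub0r normrN.
split; first by apply/cvg_ex; exists (2 * pospart x).
exact/cvg_lim.
Unshelve. all: by end_near. Qed.

Lemma pospart_continuous : continuous pospart.
Proof. by move=> x; apply: continuous_max; [exact: cvg_cst|exact: cvg_id]. Qed.

(* A C^1 step: the second difference of a truncated parabola rises from 0 to 1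
   on [0, 2d]. *)
Definition step d x : R :=
  (pospart x ^+ 2 - 2 * pospart (x - d) ^+ 2 + pospart (x - 2 * d) ^+ 2) / (2 * d ^+ 2).

(** The derivative of [step d]: a continuous tent on [0, 2d] of height 1/d, hence of mass 1,
    approximating a Dirac mass at 0 from the right. *)
Definition dstep d x : R :=
  (pospart x - 2 * pospart (x - d) + pospart (x - 2 * d)) / d ^+ 2.

Lemma is_derive_step d c x : 0 < d ->
  is_derive x 1 (fun y => step d (y - c)) (dstep d (x - c)).
Proof.
move=> d0.
have D (k : R) : is_derive x 1 (fun y => pospart (y - k) ^+ 2) (2 * pospart (x - k)).
  have E : is_derive x 1 (fun y : R => y - k) 1.
    by apply: is_derive_eq; rewrite subr0.
  have := @is_derive1_comp _ (fun y => pospart y ^+ 2) (fun y => y - k) x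
    (2 * pospart (x - k)) 1 (is_derive_pospart_sqr _) E.
  by rewrite mulr1.
have := D c; have := D (c + d); have := D (c + 2 * d) => D1 D2 D3.
have -> : (fun y => step d (y - c)) = (fun y => (2 * d ^+ 2)^-1 *:
   (pospart (y - c) ^+ 2 - (2 : R) *: pospart (y - (c + d)) ^+ 2
    + pospart (y - (c + 2 * d)) ^+ 2)).
  by apply/funext => y; rewrite /step !opprD !addrA mulrC.
apply: is_derive_eq; rewrite /dstep !opprD !addrA /GRing.scale/=.
by field; rewrite gt_eqF.
Qed.

Lemma dstep_continuous d c : continuous (fun x => dstep d (x - c)).
Proof.
have C (k : R) : continuous (fun y => pospart (y - k)).
  move=> y; apply: (@continuous_comp _ _ _ (fun y => y - k) pospart).
    by apply: cvgB; [exact: cvg_id|exact: cvg_cst].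
  exact: pospart_continuous.
have -> : (fun y => dstep d (y - c)) = (fun y =>
   (pospart (y - c) - (2 : R) * pospart (y - (c + d))
    + pospart (y - (c + 2 * d))) * (d ^+ 2)^-1).
  by apply/funext => y; rewrite /dstep !opprD !addrA.
move=> y; apply: cvgMl; apply: cvgD; last exact: C.
by apply: cvgB; [exact: C|apply: cvgMr; exact: C].
Qed.

Lemma step_le0 d x : 0 < d -> x <= 0 -> step d x = 0 /\ dstep d x = 0.
Proof.
move=> d0 x0.
have p y : y <= 0 -> pospart y = 0 by case: (pospartP y) => -[] //; lra.
by rewrite /step /dstep !p; lra.
Qed.

Lemma step_ge d x : 0 < d -> 2 * d <= x -> step d x = 1 /\ dstep d x = 0.
Proof.
move=> d0 x0.
have p y : 0 <= y -> pospart y = y by case: (pospartP y) => -[] //; lra.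
by rewrite /step /dstep !p//; try lra; split; field; rewrite gt_eqF.
Qed.

Lemma dstep_ge0 d x : 0 < d -> 0 <= dstep d x.
Proof.
move=> d0; apply: divr_ge0; last exact: sqr_ge0.
by case: (pospartP x) => -[? ->]; case: (pospartP (x - d)) => -[? ->];
  case: (pospartP (x - 2 * d)) => -[? ->]; lra.
Qed.

Lemma step_itv01 d x : 0 < d -> 0 <= step d x <= 1.
Proof.
move=> d0; have dd : 0 < 2 * d ^+ 2 by rewrite mulr_gt0// exprn_gt0.
rewrite /step ler_pdivlMr// ler_pdivrMr// mul0r mul1r.
by case: (pospartP x) => -[? ->]; case: (pospartP (x - d)) => -[? ->];
  case: (pospartP (x - 2 * d)) => -[? ->]; apply/andP; split; nra.
Qed.

Lemma continuous_modulus f c (e : R) : continuous f -> 0 < e ->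
  exists2 d : R, 0 < d & forall x, `|x - c| < d -> `|f x - f c| < e.
Proof.
move=> cf e0; have /cvgrPdist_lt/(_ _ e0)[d /= d0 H] := cf c.
by exists d => // x xc; rewrite distrC; apply: H; rewrite /= distrC.
Qed.

Lemma Rintegral_dstep d c : 0 < d ->
  \int[mu]_(x in `[c, c + 2 * d]) dstep d (x - c) = 1.
Proof.
move=> d0; have cc : c < c + 2 * d by lra.
have ds x := is_derive_step c x d0.
have cs : continuous (fun x => step d (x - c)).
  by move=> x; apply/differentiable_continuous/derivable1_diffP; case: (ds x).
rewrite /Rintegral (@continuous_FTC2 _ _ (fun x => step d (x - c)))//.
- rewrite -EFinB/= subrr (step_le0 d0 (lexx 0)).1 subr0.
  by rewrite (step_ge d0 _).1//; lra.
- exact/continuous_subspaceT/dstep_continuous.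
- split; first by move=> x _; case: (ds x).
    exact/cvg_at_right_filter/cs.
  exact/cvg_at_left_filter/cs.
- by move=> x _; rewrite derive1E; case: (ds x).
Qed.

(** The weight is nonnegative of mass 1, so the integral is a weighted mean of values of F near
    [F c]. *)
Lemma dstep_approx F c d (e : R) : 0 < d -> continuous F ->
  (forall x, c <= x <= c + 2 * d -> `|F x - F c| <= e) ->
  `|\int[mu]_(x in `[c, c + 2 * d]) (F x * dstep d (x - c)) - F c| <= e.
Proof.
move=> d0 cF Fe; have Ls := Lloc1_continuous (@dstep_continuous d c).
have Fc : \int[mu]_(x in `[c, c + 2 * d]) (F c * dstep d (x - c)) = F c.
  by rewrite RintegralZl_itvcc// Rintegral_dstep// mulr1.
rewrite -[X in _ - X]Fc.
rewrite -RintegralB_itvcc; [|exact: Lloc1_continuousM|exact: Lloc1Z].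
apply: le_trans (@le_normr_Rintegral_itvcc _ _ (fun x => e * dstep d (x - c)) _ _ _ _ _) _.
- by apply: Lloc1B; [exact: Lloc1_continuousM|exact: Lloc1Z].
- exact: Lloc1Z.
- move=> x; rewrite in_itv/= => xc; rewrite -mulrBl normrM (ger0_norm (dstep_ge0 _ d0)).
  by rewrite ler_wpM2r ?dstep_ge0// Fe.
- by rewrite RintegralZl_itvcc// Rintegral_dstep// mulr1.
Qed.

End smooth_step.

(** * A continuous function is a primitive of its weak derivative *)

Section primitive_of_weak_derivative.
Context {R : realType}.
Local Notation mu := (@lebesgue_measure R).
Implicit Types (f g F phi : R -> R) (a b c d x : R).

(** The weak derivative is tested on a C^1 approximation of the indicator of [a, b]: the side with F
    tends to [F a - F b], the side with g to minus the integral of g over [a, b]. *)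
Lemma weak_deriv_primitive F g : continuous F -> weak_deriv F g -> primitive F g.
Proof.
move=> cF [Lg wFg]; split=> // a b; rewrite le_eqVlt => /predU1P[<-|ab].
  by rewrite set_itv1 Rintegral_set1 subrr.
apply/eqP; rewrite -subr_eq0 -normr_le0; apply/ler_addgt0Pr => e' e'0.
(* One quarter for each of the errors [E1] to [E4]: two from g and two from F, at the two ends. *)
rewrite add0r; pose e := e' / 4; have e0 : 0 < e by rewrite divr_gt0.
pose N := oriented_integral (fun x => `|g x|) 0.
have LNg := Lloc1_norm Lg.
have PN := primitive_oriented_integral LNg.
have cN := primitive_continuous PN.
have [da da0 Fa] := continuous_modulus a cF e0.
have [db db0 Fb] := continuous_modulus b cF e0.
have [na na0 Na] := continuous_modulus a cN e0.
have [nb nb0 Nb] := continuous_modulus b cN e0.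
(* The term [b - a] keeps the rise on [a, a + 2d] and the fall on [b, b + 2d] apart. With
   [d = m / 4], the width 2d stays strictly below each modulus. *)
pose m := Num.min (Num.min da db) (Num.min (Num.min na nb) (b - a)).
have m0 : 0 < m by rewrite !lt_min da0 db0 na0 nb0 subr_gt0.
pose d := m / 4; have d0 : 0 < d by rewrite divr_gt0.
have : d * 4 <= m by rewrite /d; lra.
rewrite !le_min => /andP[/andP[dda ddb] /andP[/andP[dna dnb] dba]].
pose phi x := step d (x - a) - step d (x - b).
pose phi' x := dstep d (x - a) - dstep d (x - b).
have dphi x : is_derive x 1 phi (phi' x).
  have D1 := is_derive_step a x d0; have D2 := is_derive_step b x d0.
  exact: is_deriveB.
have phi'E : derive1 phi = phi'.
  by apply/funext => x; rewrite derive1E; case: (dphi x).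
have cphi' : continuous phi'.
  by move=> x; apply: cvgB; exact: dstep_continuous.
have cphi : continuous phi.
  by move=> x; apply/differentiable_continuous/derivable1_diffP; case: (dphi x).
have phi0 x : x \notin `[a, b + 2 * d] -> phi x = 0 /\ phi' x = 0.
  rewrite in_itv/= negb_and -!ltNge /phi /phi' => /orP[xa|xb].
    have [-> ->] := @step_le0 _ d (x - a) d0 ltac:(lra).
    by have [-> ->] := @step_le0 _ d (x - b) d0 ltac:(lra); rewrite subrr.
  have [-> ->] := @step_ge _ d (x - a) d0 ltac:(lra).
  by have [-> ->] := @step_ge _ d (x - b) d0 ltac:(lra); rewrite !subrr.
have tphi : test_fun phi.
  split; [by move=> x; case: (dphi x)|by rewrite phi'E|].
  exists (`|a| + `|b + 2 * d|) => x xM; apply: (phi0 x _).1.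
  rewrite in_itv/= negb_and -!ltNge.
  have := ler_norm (b + 2 * d); have := ler_norm (- a); rewrite normrN.
  have [x0|x0] := leP 0 x; move: xM; have := normr_ge0 a; have := normr_ge0 (b + 2 * d).
    by rewrite (ger0_norm x0) => *; apply/orP; right; lra.
  by rewrite (ltr0_norm x0) => *; apply/orP; left; lra.
have := wFg phi tphi; rewrite phi'E.
have sup0 c x : x \notin `[c, c + 2 * d] -> F x * dstep d (x - c) = 0.
  rewrite in_itv/= negb_and -!ltNge => /orP[xc|xc].
    by rewrite (step_le0 d0 _).2 ?mulr0//; lra.
  by rewrite (step_ge d0 _).2 ?mulr0//; lra.
have LF c := Lloc1_continuousM cF (Lloc1_continuous (@dstep_continuous _ d c)).
have -> : \int[mu]_x (F x * phi' x) =
    \int[mu]_(x in `[a, a + 2 * d]) (F x * dstep d (x - a))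
    - \int[mu]_(x in `[b, b + 2 * d]) (F x * dstep d (x - b)).
  rewrite (@Rintegral_support _ _ a (b + 2 * d)); last first.
    by move=> x /phi0[_ ->]; rewrite mulr0.
  rewrite -(Rintegral_support (sup0 a)) -(Rintegral_support (sup0 b)).
  rewrite (@Rintegral_support _ _ a (b + 2 * d)); last first.
    move=> x xab; apply: sup0; apply: contra xab; rewrite !in_itv/= => /andP[-> xb].
    by lra.
  rewrite (@Rintegral_support _ (fun x => F x * dstep d (x - b)) a (b + 2 * d)); last first.
    move=> x xab; apply: sup0; apply: contra xab; rewrite !in_itv/= => /andP[xb ->].
    by rewrite andbT; lra.
  by rewrite -RintegralB_itvcc//; apply: eq_Rintegral => x _; rewrite mulrBr.
have Lgphi : Lloc 1%:E (fun x => g x * phi x).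
  have := Lloc1_continuousM cphi Lg; congr (Lloc _ _).
  by apply/funext => x; rewrite mulrC.
rewrite (@Rintegral_support _ (fun x => g x * phi x) a (b + 2 * d)); last first.
  by move=> x /phi0[-> _]; rewrite mulr0.
rewrite (@Rintegral_itv_split _ _ a b)//; [|exact: ltW|lra].
have phi01 x : `|phi x| <= 1.
  rewrite /phi ler_norml; have /andP[? ?] := step_itv01 (x - a) d0.
  by have /andP[? ?] := step_itv01 (x - b) d0; apply/andP; split; lra.
have phi1 x : x \in `[a, b] -> `|phi x - 1| <= 1 /\ (a + 2 * d <= x -> phi x = 1).
  rewrite in_itv/= => /andP[ax xb]; rewrite /phi.
  have -> : step d (x - b) = 0 by apply: (step_le0 d0 _).1; lra.
  rewrite subr0; split; last by move=> ?; apply: (step_ge d0 _).1; lra.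
  have /andP[? ?] := step_itv01 (x - a) d0.
  by rewrite ler_norml; apply/andP; split; lra.
have E1 : `|\int[mu]_(x in `[b, b + 2 * d]) (g x * phi x)| <= e.
  apply: le_trans (@le_normr_Rintegral_itvcc _ _ (fun x => `|g x|) _ _ _ _ _) _ => //.
    by move=> x _; rewrite normrM -[leRHS]mulr1 ler_pM.
  rewrite PN.2; last by lra.
  by rewrite (le_trans (ler_norm _))// ltW// Nb// addrAC subrr add0r gtr0_norm; lra.
have E2 : `|\int[mu]_(x in `[a, b]) (g x * phi x) - \int[mu]_(x in `[a, b]) g x| <= e.
  rewrite -RintegralB_itvcc// (@Rintegral_itv_split _ _ a (a + 2 * d)); [|exact: Lloc1B|lra|lra].
  rewrite (@eq_Rintegral _ _ _ mu `[a + 2 * d, b]%classic (cst 0)); last first.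
    move=> x; rewrite inE/= in_itv/= => /andP[xa xb].
    by rewrite (phi1 x _).2 ?mulr1 ?subrr// in_itv/= xb andbT; lra.
  rewrite Rintegral_cst// mul0r addr0.
  apply: le_trans (@le_normr_Rintegral_itvcc _ _ (fun x => `|g x|) _ _ _ _ _) _ => //.
  - exact: Lloc1B.
  - move=> x; rewrite in_itv/= => /andP[xa xb].
    rewrite -{2}[g x]mulr1 -mulrBr normrM -[leRHS]mulr1 ler_pM// (phi1 _ _).1//.
    by rewrite in_itv/= xa; lra.
  - rewrite PN.2; last by lra.
    by rewrite (le_trans (ler_norm _))// ltW// Na// addrAC subrr add0r gtr0_norm; lra.
have E3 : `|\int[mu]_(x in `[a, a + 2 * d]) (F x * dstep d (x - a)) - F a| <= e.
  apply: dstep_approx => // x /andP[xa xb]; rewrite ltW// Fa// ger0_norm; lra.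
have E4 : `|\int[mu]_(x in `[b, b + 2 * d]) (F x * dstep d (x - b)) - F b| <= e.
  apply: dstep_approx => // x /andP[xa xb]; rewrite ltW// Fb// ger0_norm; lra.
move: E1 E2 E3 E4; rewrite !ler_norml /e => /andP[? ?] /andP[? ?] /andP[? ?] /andP[? ?] ?.
by apply/andP; split; lra.
Qed.

Lemma wderivP F g : weak_deriv F g -> weak_deriv F (wderiv F).
Proof. by move=> Fg; exact: (xgetPex _ (ex_intro _ g Fg)). Qed.

(** The gateway to [wderiv]: whatever weak derivative was picked, it integrates back to F, so it
    equals any other density of F almost everywhere. *)
Lemma primitive_wderiv F g : primitive F g -> primitive F (wderiv F).
Proof.
move=> Fg; apply: weak_deriv_primitive; first exact: primitive_continuous Fg.
exact: wderivP (primitive_weak_deriv Fg).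
Qed.

Lemma wderiv_ae F g : primitive F g -> \forall x \ae mu, wderiv F x = g x.
Proof. by move=> Fg; exact: primitive_ae_unique (primitive_wderiv Fg) Fg. Qed.

End primitive_of_weak_derivative.

(** * Change of variables *)

Section density_image.
Context {R : realType} (G r : R -> R).
Local Notation mu := (@lebesgue_measure R).
Context (mG : measurable_fun setT G) (mr : measurable_fun setT r)
  (r0 : forall x, 0 <= r x).

(** The push-forward by G of the measure r dx. It is registered as a measure so that the uniqueness
    of Lebesgue measure applies to it. *)
Definition density_image (A : set (measurableTypeR R)) : \bar R :=
  (\int[mu]_(x in G @^-1` A) (r x)%:E)%E.

Let density_image0 : density_image set0 = 0%E.
Proof. by rewrite /density_image preimage_set0 integral_set0. Qed.

Let density_image_ge0 A : (0 <= density_image A)%E.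
Proof. by apply: integral_ge0 => x _; rewrite lee_fin. Qed.

Let density_image_sigma_additive : semi_sigma_additive density_image.
Proof.
move=> F mF tF mUF; rewrite /density_image preimage_bigcup.
apply: (@semi_sigma_additive_nng_induced _ _ _ mu (EFin \o r)).
- exact/measurable_EFinP.
- by move=> x; rewrite lee_fin.
- by move=> n; have := mG measurableT (mF n); rewrite setTI.
- apply/trivIsetP => /= i j _ _ ij; rewrite -preimage_setI.
  by move/trivIsetP : tF => /(_ _ _ _ _ ij) ->//; rewrite preimage_set0.
- by have := mG measurableT mUF; rewrite setTI preimage_bigcup.
Qed.

HB.instance Definition _ := isMeasure.Build _ _ _ density_image
  density_image0 density_image_ge0 density_image_sigma_additive.

Definition density_image_measure : {measure set (measurableTypeR R) -> \bar R} :=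
  density_image.

End density_image.

(** * Substitution for nonnegative integrands *)

Section change_of_variables.
Context {R : realType}.
Local Notation mu := (@lebesgue_measure R).
Implicit Types (G r y : R -> R) (k : R -> R) (a b : R).

(** It suffices to compare the two measures on intervals []a, b]]: the preimage is []y a, y b]],
    whose r-mass is G (y b) - G (y a) = b - a. *)
Lemma lebesgue_density_image G r y : primitive G r -> (forall x, 0 <= r x) ->
  {homo y : x z / x <= z} -> {homo G : x z / x <= z} ->
  cancel y G -> cancel G y ->
  forall A, measurable A -> mu A = (\int[mu]_(x in G @^-1` A) (r x)%:E)%E.
Proof.
move=> PG r0 homy homG yK GK A mA; have [Lr Gr] := PG.
have mG : measurable_fun setT G.
  by apply: continuous_measurable_fun; exact: primitive_continuous PG.
have mr := Lloc1_measurable Lr.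
rewrite -[RHS]/(density_image_measure mG mr r0 A).
apply: lebesgue_measure_unique => //= _ [[a b]] /= _ <-.
rewrite /density_image.
have -> : G @^-1` `]a, b]%classic = `]y a, y b]%classic.
  apply/seteqP; split => x /=; rewrite !in_itv/=.
    move=> /andP[ax xb]; rewrite -[x]GK (homy _ _ xb) andbT lt_neqAle (homy _ _ (ltW ax)).
    by rewrite andbT; apply: contraTneq ax => /(can_inj yK) ->; rewrite ltxx.
  move=> /andP[ax xb]; rewrite -[b]yK (homG _ _ xb) andbT lt_neqAle.
  rewrite -{2}[a]yK (homG _ _ (ltW ax)) andbT.
  by apply: contraTneq ax => ->; rewrite GK ltxx.
rewrite lebesgue_measure_itv/= lte_fin; have [ab|ba] := ltP a b; last first.
  by rewrite set_itv_ge ?integral_set0// bnd_simp -leNgt homy.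
have yab := homy _ _ (ltW ab).
rewrite -[RHS]fineK; last first.
  apply: (integrable_fin_num) => //.
  by apply: (@Lloc1_integrable _ _ _ (y a) (y b)) => //; exact: subset_itv_oc_cc.
rewrite -/(Rintegral mu _ r) Rintegral_itv_obnd_cbnd; last first.
  by apply: (@Lloc1_integrable _ _ _ (y a) (y b)) => //; exact: subset_itv_oc_cc.
by rewrite Gr// !yK EFinB.
Qed.

Local Open Scope ereal_scope.
Import HBNNSimple.

(** The hypothesis on sets gives the formula for indicators, hence for simple functions; monotone
    convergence does the rest. *)
Lemma ge0_integral_density_image (G : measurableTypeR R -> measurableTypeR R)
    (r : measurableTypeR R -> R) (k : measurableTypeR R -> \bar R) :
  measurable_fun setT G -> measurable_fun setT r -> (forall x, 0 <= r x)%R ->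
  (forall A, measurable A -> mu A = \int[mu]_(x in G @^-1` A) (r x)%:E) ->
  measurable_fun setT k -> (forall x, 0 <= k x) ->
  \int[mu]_x k x = \int[mu]_x (k (G x) * (r x)%:E).
Proof.
move=> mG mr r0 muE mk k0.
pose h := nnsfun_approx measurableT mk.
have kh x : (EFin \o h^~ x) @ \oo --> k x.
  exact: (cvg_nnsfun_approx measurableT mk (fun x _ => k0 x)).
have mono x m n : (m <= n)%N -> (h m x <= h n x)%R.
  by move=> mn; exact/lefP/nd_nnsfun_approx.
have mrE : measurable_fun setT (EFin \o r) by exact/measurable_EFinP.
have mhG n : measurable_fun setT (h n \o G) by exact: measurableT_comp.
transitivity (limn (fun n => \int[mu]_x (h n x)%:E)).
  rewrite -monotone_convergence//.
  - by apply: eq_integral => x _; apply/esym/cvg_lim => //; exact: kh.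
  - by move=> n; apply/measurable_EFinP; exact: (@measurable_funPT _ _ _ _ (h n)).
  - by move=> n x _; rewrite lee_fin.
  - by move=> x _ m n mn; rewrite lee_fin mono.
transitivity (limn (fun n => \int[mu]_x ((h n (G x))%:E * (r x)%:E))); last first.
  rewrite -monotone_convergence//.
  - apply: eq_integral => x _; apply/cvg_lim => //.
    by apply: cvgeZr => //; exact: kh.
  - by move=> n; apply: emeasurable_funM => //; apply/measurable_EFinP; exact: mhG.
  - by move=> n x _; rewrite mule_ge0 ?lee_fin.
  - by move=> x _ m n mn; rewrite lee_wpmul2r ?lee_fin// mono.
congr (limn _); apply/funext => n.
transitivity (\sum_(z \in range (h n)) (z%:E * \int[mu]_(x in G @^-1` (h n @^-1` [set z])) (r x)%:E)).
  under eq_integral do rewrite fimfunE -fsumEFin//.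
  rewrite ge0_integral_fsum//; last 2 first.
  - by move=> z; apply/measurable_EFinP; apply: measurable_funM.
  - by move=> z x _; rewrite nnfun_muleindic_ge0.
  apply: eq_fsbigr => z _; rewrite integralZl_indic_nnsfun// integral_indic//.
  by rewrite setIT; congr (_ * _); apply: muE.
transitivity (\int[mu]_x (\sum_(z \in range (h n)) (z%:E * ((\1_(h n @^-1` [set z]) (G x))%:E * (r x)%:E)))); last first.
  apply: eq_integral => x _; rewrite [in RHS]fimfunE -fsumEFin//.
  rewrite ge0_mule_fsuml => [|z]; last by rewrite nnfun_muleindic_ge0.
  by apply: eq_fsbigr => z _; rewrite EFinM muleA.
have mI z : measurable_fun setT (fun x => (\1_(h n @^-1` [set z]) (G x))%:E * (r x)%:E).
  apply: emeasurable_funM => //; apply/measurable_EFinP.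
  exact: (measurableT_comp (measurable_indic _)).
rewrite ge0_integral_fsum//; last 2 first.
- by move=> z; exact: measurable_funeM.
- move=> z x _; rewrite muleA mule_ge0 ?lee_fin//.
  exact: nnfun_muleindic_ge0.
apply: eq_fsbigr => z; rewrite inE => -[t _ <-].
rewrite ge0_integralZl//; last 2 first.
- by move=> x _; rewrite mule_ge0 ?lee_fin.
- by rewrite lee_fin.
congr (_ * _); rewrite [LHS]integral_mkcond; apply: eq_integral => x _.
rewrite patchE indicE; case: ifPn => xin.
  by rewrite (_ : (G x \in _) = true) ?mul1e// inE; rewrite inE in xin.
rewrite (_ : (G x \in _) = false) ?mul0e//; apply/negbTE.
by apply: contra xin; rewrite !inE.
Qed.

(** The global formula is applied to [k \o y] cut off to [a, b]; composing with G turns this into k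
    cut off to [y a, y b]. *)
Lemma ge0_change_of_variables G r y k a b : primitive G r -> (forall x, 0 <= r x)%R ->
  {homo y : x z / x <= z}%R -> {homo G : x z / x <= z}%R ->
  cancel y G -> cancel G y ->
  measurable_fun setT k -> (forall x, 0 <= k x)%R ->
  \int[mu]_(x in `[a, b]) (k (y x))%:E = \int[mu]_(x in `[y a, y b]) (k x * r x)%:E.
Proof.
move=> PG r0 homy homG yK GK mk k0.
have mG : measurable_fun setT G.
  by apply: continuous_measurable_fun; exact: primitive_continuous PG.
have mr := Lloc1_measurable PG.1.
have my : measurable_fun setT y by exact: nondecreasing_measurable.
rewrite integral_mkcond [RHS]integral_mkcond.
rewrite (@ge0_integral_density_image G r)//.
- apply: eq_integral => x _; rewrite !patchE.
  have -> : (G x \in `[a, b]%classic) = (x \in `[y a, y b]%classic).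
    apply/idP/idP; rewrite !inE/= !in_itv/= => /andP[ax xb].
      by rewrite -[x]GK !homy.
    by rewrite -[a]yK -[b]yK !homG.
  by case: ifPn => // _; rewrite ?GK ?EFinM// mul0e.
- exact: (lebesgue_density_image PG r0 homy homG yK GK).
- apply/(measurable_restrictT _ _).1 => //.
  apply/measurable_EFinP; apply: measurable_funTS.
  exact: (measurableT_comp mk my).
- by move=> x; rewrite patchE; case: ifP; rewrite ?lee_fin.
Qed.

End change_of_variables.

(** * Substitution for real integrands and the chain rule *)

Section change_of_variables_real.
Context {R : realType}.
Local Notation mu := (@lebesgue_measure R).
Implicit Types (F G f g k r y : R -> R) (a b c : R) (P Q : R -> Prop).

Lemma ae_sub P Q : (forall x, P x -> Q x) ->
  (\forall x \ae mu, P x) -> \forall x \ae mu, Q x.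
Proof. by move=> PQ; apply: filterS; first exact: (ae_filter_ringOfSetsType mu). Qed.

Lemma ae_and P Q : (\forall x \ae mu, P x) -> (\forall x \ae mu, Q x) ->
  \forall x \ae mu, P x /\ Q x.
Proof.
by move=> aP aQ; apply: filterI => //; exact: (ae_filter_ringOfSetsType mu).
Qed.

Lemma eq_ae_Rintegral f g (D : set R) : measurable D ->
  measurable_fun setT f -> measurable_fun setT g ->
  (\forall x \ae mu, f x = g x) ->
  \int[mu]_(x in D) f x = \int[mu]_(x in D) g x.
Proof.
move=> mD mf mg fg; congr fine; apply: ae_eq_integral => //.
- by apply/measurable_EFinP; exact: measurable_funTS.
- by apply/measurable_EFinP; exact: measurable_funTS.
- by apply: ae_sub fg => x -> _.
Qed.

Lemma Lloc1_ae f g : measurable_fun setT f -> Lloc 1%:E g ->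
  (\forall x \ae mu, f x = g x) -> Lloc 1%:E f.
Proof.
move=> mf Lg fg; apply/Lloc1P; split=> // a b.
have /integrableP[mgab] := Lloc1_itvcc a b Lg.
have mfE : measurable_fun `[a, b]%classic (EFin \o f).
  by apply/measurable_EFinP; exact: measurable_funTS.
move=> goo; apply/integrableP; split => //; apply: le_lt_trans goo.
rewrite le_eqVlt; apply/orP; left; apply/eqP; apply: ae_eq_integral => //.
- exact: measurableT_comp.
- exact: measurableT_comp.
- by apply: ae_sub fg => x /= -> _.
Qed.

(* The substitution x = y(s), with G the inverse of y and r the density of G. *)
Definition substitution G r y :=
  [/\ primitive G r, (forall x, 0 <= r x),
      {homo y : x z / x <= z} /\ {homo G : x z / x <= z} & cancel y G /\ cancel G y].

Lemma substitution_measurable G r y : substitution G r y -> measurable_fun setT y.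
Proof. by move=> [_ _ [homy _] _]; exact: nondecreasing_measurable. Qed.

Lemma ge0_Rintegral_substitution G r y k a b : substitution G r y ->
  measurable_fun setT k -> (forall x, 0 <= k x) ->
  \int[mu]_(x in `[a, b]) k (y x) = \int[mu]_(x in `[y a, y b]) (k x * r x).
Proof.
move=> [PG r0 [homy homG] [yK GK]] mk k0.
by rewrite /Rintegral (ge0_change_of_variables _ _ PG).
Qed.

Lemma Lloc1_substitution G r y k : substitution G r y ->
  measurable_fun setT k -> Lloc 1%:E (fun x => k x * r x) ->
  Lloc 1%:E (k \o y).
Proof.
move=> subst mk Lkr; have my := substitution_measurable subst.
have [PG r0 [homy homG] [yK GK]] := subst.
have mky : measurable_fun setT (k \o y) by exact: measurableT_comp.
apply/Lloc1P; split=> // a b; apply/integrableP; split.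
  by apply/measurable_EFinP; exact: measurable_funTS.
have mk' : measurable_fun setT (fun x => `|k x|) by exact: measurableT_comp.
rewrite (_ : (fun _ => _) = (fun x => (`|k (y x)|)%:E)); last exact/funext.
rewrite (ge0_change_of_variables _ _ PG r0 homy homG yK GK mk')//.
have /integrableP[_] := Lloc1_itvcc (y a) (y b) Lkr.
by under eq_integral do rewrite /= normrM (ger0_norm (r0 _)).
Qed.

Lemma Rintegral_substitution G r y k a b : substitution G r y ->
  measurable_fun setT k -> Lloc 1%:E (fun x => k x * r x) ->
  \int[mu]_(x in `[a, b]) k (y x) = \int[mu]_(x in `[y a, y b]) (k x * r x).
Proof.
move=> subst mk Lkr; have [[Lr _] r0 _ _] := subst.
have mk' : measurable_fun setT (fun x => `|k x|) by exact: measurableT_comp.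
have Lkr' : Lloc 1%:E (fun x => `|k x| * r x).
  have := Lloc1_norm Lkr; congr (Lloc _ _); apply/funext => x.
  by rewrite normrM (ger0_norm (r0 x)).
have Lk := Lloc1_substitution subst mk Lkr.
have Lk' := Lloc1_norm Lk.
(* k is written as the difference of the nonnegative functions k + |k| and |k|. *)
have E1 : \int[mu]_(x in `[a, b]) k (y x) =
    \int[mu]_(x in `[a, b]) (k (y x) + `|k (y x)|) - \int[mu]_(x in `[a, b]) `|k (y x)|.
  by rewrite RintegralD_itvcc// addrK.
have E2 : \int[mu]_(x in `[y a, y b]) (k x * r x) =
    \int[mu]_(x in `[y a, y b]) ((k x + `|k x|) * r x) -
    \int[mu]_(x in `[y a, y b]) (`|k x| * r x).
  rewrite -[LHS](addrK (\int[mu]_(x in `[y a, y b]) (`|k x| * r x))).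
  rewrite -RintegralD_itvcc//; congr (_ - _).
  by apply: eq_Rintegral => x _; rewrite mulrDl.
rewrite E1 E2; congr (_ - _).
  apply: (@ge0_Rintegral_substitution G r y (fun x => k x + `|k x|)) => //.
    exact: measurable_funD.
  by move=> x; have := ler_norm (- k x); rewrite normrN; lra.
exact: (@ge0_Rintegral_substitution G r y (fun x => `|k x|)).
Qed.

(** The chain rule without differentiating y: r is the density of the inverse of y, and k stands for
    F' / r. *)
Lemma substitution_primitive F G r y k : substitution G r y ->
  measurable_fun setT k -> primitive F (fun x => k x * r x) ->
  primitive (F \o y) (k \o y).
Proof.
move=> subst mk [Lkr Fkr]; split; first exact: Lloc1_substitution subst mk Lkr.
move=> a b ab; rewrite (Rintegral_substitution _ _ subst)// Fkr//.
by have [_ _ [homy _] _] := subst; exact: homy.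
Qed.

Lemma primitiveDl F g c : primitive F g -> primitive (fun x => F x + c) g.
Proof. by move=> [Lg Fg]; split=> // a b ab; rewrite Fg//; ring. Qed.

Lemma substitution_shift c : substitution (fun x => x - c) (fun=> 1) (fun x => x + c).
Proof.
split=> //; first exact: (primitiveDl _ (primitive_id)).
- by split=> x z xz; rewrite lerD2r.
- by split=> x; [rewrite addrK|rewrite subrK].
Qed.

Lemma primitive_shift F g c : primitive F g ->
  primitive (fun x => F (x + c)) (fun x => g (x + c)).
Proof.
move=> Fg; apply: (substitution_primitive (substitution_shift c)).
  exact: Lloc1_measurable Fg.1.
by have := Fg; congr primitive; apply/funext => x; rewrite mulr1.
Qed.

Lemma Rintegral_shift g a b c : Lloc 1%:E g ->
  \int[mu]_(x in `[a, b]) g (x + c) = \int[mu]_(x in `[a + c, b + c]) g x.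
Proof.
move=> Lg; rewrite (Rintegral_substitution _ _ (substitution_shift c)).
- by apply: eq_Rintegral => x _; rewrite mulr1.
- exact: Lloc1_measurable.
- by have := Lg; congr (Lloc _ _); apply/funext => x; rewrite mulr1.
Qed.

End change_of_variables_real.

(** * The energy measure *)

Section energy_density.
Context {R : realType}.
Local Notation mu := (@lebesgue_measure R).
Implicit Types (u v : H1per R) (a b c x : R).

Lemma H1_continuous u : continuous u.
Proof. by have [[]] := H1funP u. Qed.

Lemma H1_primitive u : primitive u (wderiv u).
Proof.
have [[cu _ [g ug _]] _] := H1funP u.
exact: weak_deriv_primitive (wderivP ug).
Qed.

(** [wderiv u] need not be the square integrable weak derivative that [W1loc] provides, but the two
    agree almost everywhere. *)
Lemma H1_wderiv_sqr u : Lloc 1%:E (fun x => wderiv u x ^+ 2).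
Proof.
have [[cu _ [g ug Lg]] _] := H1funP u.
have ae := wderiv_ae (weak_deriv_primitive cu ug).
apply: Lloc1_ae (Lloc2_sqr Lg) _; first by apply: measurable_funX; exact: measurable_wderiv.
by apply: ae_sub ae => x ->.
Qed.

Definition edens u x : R := u x ^+ 2 + wderiv u x ^+ 2.

Lemma edens_ge0 u x : 0 <= edens u x.
Proof. by rewrite addr_ge0// sqr_ge0. Qed.

Lemma Lloc1_edens u : Lloc 1%:E (edens u).
Proof.
apply: Lloc1D; last exact: H1_wderiv_sqr.
apply: Lloc1_continuous => x; apply: (@continuousM _ _ u u); exact: H1_continuous.
Qed.

Lemma measurable_edens u : measurable_fun setT (edens u).
Proof. by apply: Lloc1_measurable; exact: Lloc1_edens. Qed.

Lemma edens_periodic u : \forall x \ae mu, edens u (x + 1) = edens u x.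
Proof.
have [_ pu] := H1funP u.
have uu : (fun x => u (x + 1)) = u by apply/funext.
have := primitive_shift 1 (H1_primitive u); rewrite uu => /primitive_ae_unique.
move=> /(_ _ (H1_primitive u)); apply: ae_sub => x wx.
by rewrite /edens wx pu.
Qed.

(* Locked, as are later integrals of u: unification would unfold them at length. *)
Definition total_energy := locked (fun u => \int[mu]_(x in `[0, 1]) edens u x).

Lemma total_energyE u : total_energy u = \int[mu]_(x in `[0, 1]) edens u x.
Proof. by rewrite /total_energy -lock. Qed.

Lemma total_energy_ge0 u : 0 <= total_energy u.
Proof. by rewrite total_energyE; apply: Rintegral_ge0 => x _; exact: edens_ge0. Qed.

Definition energy_upto := locked (fun u => oriented_integral (edens u) 0).

Lemma energy_uptoE u : energy_upto u = oriented_integral (edens u) 0.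
Proof. by rewrite /energy_upto -lock. Qed.

Lemma primitive_energy_upto u : primitive (energy_upto u) (edens u).
Proof. by rewrite energy_uptoE; apply: primitive_oriented_integral; exact: Lloc1_edens. Qed.

Lemma energy_upto_homo u : {homo energy_upto u : x y / x <= y}.
Proof.
move=> x y xy; rewrite -subr_ge0 -(primitive_energy_upto u).2//.
by apply: Rintegral_ge0 => z _; exact: edens_ge0.
Qed.

Lemma energy_upto0 u : energy_upto u 0 = 0.
Proof. by rewrite energy_uptoE /oriented_integral lexx set_itv1 Rintegral_set1. Qed.

Lemma energy_upto1 u : energy_upto u 1 = total_energy u.
Proof. by rewrite energy_uptoE /oriented_integral ler01 total_energyE. Qed.

Lemma energy_uptoD1 u x : energy_upto u (x + 1) = energy_upto u x + total_energy u.
Proof.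
have [Le Pe] := primitive_energy_upto u.
have E a b : a <= b -> energy_upto u (b + 1) - energy_upto u (a + 1) =
    energy_upto u b - energy_upto u a.
  move=> ab; rewrite -!Pe ?lerD2r// -Rintegral_shift//.
  apply: eq_ae_Rintegral; [by []| |exact: measurable_edens|exact: edens_periodic].
  by apply: measurableT_comp; [exact: measurable_edens|exact: measurable_funD].
have := energy_upto0 u; have := energy_upto1 u.
have [x0|/ltW x0] := leP 0 x; have := E _ _ x0; rewrite add0r; lra.
Qed.

Lemma energy_itvco u a b : a <= b ->
  energy u `[a, b[%classic = (energy_upto u b - energy_upto u a)%:E.
Proof.
move=> ab; have iab : mu.-integrable `[a, b[%classic (EFin \o edens u).
  apply: (@Lloc1_integrable _ _ _ a b); first exact: Lloc1_edens.
  exact: subset_itv_co_cc.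
rewrite -(primitive_energy_upto u).2// -Rintegral_itv_bndo_bndc//.
by rewrite /Rintegral fineK//; exact: integrable_fin_num.
Qed.

Lemma cumul_energy u x : cumul (energy u : {measure set (measurableTypeR R) -> \bar R}) x
  = energy_upto u x.
Proof.
rewrite /cumul /=; have [x0|x0|<-] := ltgtP 0 x.
- by rewrite energy_itvco ?(ltW x0)//= energy_upto0 subr0.
- by rewrite energy_itvco ?(ltW x0)//= energy_upto0 sub0r opprK.
- by rewrite energy_upto0.
Qed.

Lemma energy_itv01 u : fine (energy u `[0, 1[%classic) = total_energy u.
Proof. by rewrite energy_itvco//= energy_upto0 subr0 energy_upto1. Qed.

Lemma energy_periodic u :
  periodic_measure (energy u : {measure set (measurableTypeR R) -> \bar R}).
Proof.
move=> A mA /=; rewrite /energy.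
have AE : [set x + 1 | x in A] = (fun x => x - 1) @^-1` A.
  apply/seteqP; split => [_ [x Ax <-]|x Ax] /=; first by rewrite addrK.
  by exists (x - 1) => //; rewrite subrK.
have ms c : measurable_fun setT (fun x : R => x + c) by exact: measurable_funD.
have mA1 : measurable [set x + 1 | x in A].
  by have := ms (- 1) measurableT _ mA; rewrite setTI AE.
have [PG r0 [homy homG] [yK GK]] := substitution_shift (- 1 : R).
rewrite [LHS]integral_mkcond.
rewrite (@ge0_integral_density_image _ (fun x : R => x + 1) (fun=> 1)) //.
- rewrite [RHS]integral_mkcond; apply: ae_eq_integral => //.
  + apply: emeasurable_funM => //.
    apply: (@measurableT_comp _ _ _ _ _ _ _ _ (fun x : R => x + 1)) => //.
    apply/(measurable_restrictT _ _).1 => //.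
    by apply/measurable_EFinP; apply: measurable_funTS; exact: measurable_edens.
  + apply/(measurable_restrictT _ _).1 => //.
    by apply/measurable_EFinP; apply: measurable_funTS; exact: measurable_edens.
  + apply: ae_sub (edens_periodic u) => x ex _.
    rewrite !patchE mule1.
    have -> : (x + 1 \in [set x + 1 | x in A]) = (x \in A).
      by rewrite AE; apply/idP/idP; rewrite !inE/= addrK.
    by case: ifP => // _; congr EFin.
- exact: (ms 1).
- move=> B mB; have GE : (fun x : R => x + 1) = (fun x => x - (-1)).
    by apply/funext => x; rewrite opprK.
  rewrite GE; exact: lebesgue_density_image PG r0 homy homG yK GK B mB.
- apply/(measurable_restrictT _ _).1 => //.
  by apply/measurable_EFinP; apply: measurable_funTS; exact: measurable_edens.
- by move=> x; rewrite patchE; case: ifP => // _; rewrite lee_fin edens_ge0.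
Qed.

Lemma inD_embed u : inD (embed u).1 (embed u).2.
Proof.
split; first exact: energy_periodic.
- move=> K cK /=; have [M [_ KM]] := compact_bounded cK.
  have KI : K `<=` `[- (M + 1), M + 1]%classic.
    by move=> x Kx; rewrite /= in_itv/= -ler_norml (KM (M + 1)) // ltrDl.
  have /integrable_lty := Lloc1_itvcc (- (M + 1)) (M + 1) (Lloc1_edens u).
  move=> /(_ (measurable_itv _)); apply: le_lt_trans.
  apply: ge0_subset_integral => //; first exact: compact_measurable.
    by apply/measurable_EFinP; apply: measurable_funTS; exact: measurable_edens.
  by move=> x _; rewrite lee_fin edens_ge0.
- split.
    apply/null_content_dominatesP => A mA A0; rewrite /= /energy.
    apply: null_set_integral => //.
    by apply/measurable_EFinP; apply: measurable_funTS; exact: measurable_edens.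
  exists mzero; last by move=> A mA; rewrite /= /mzero adde0.
  by exists set0; split => //; rewrite measure0.
Qed.

End energy_density.

(** * Lagrangian coordinates of an absolutely continuous energy *)

Section lagrangian_coordinate.
Context {R : realType}.
Local Notation mu := (@lebesgue_measure R).
Implicit Types (u v : H1per R) (a b c x s : R).

(* arclen u is the inverse of the coordinate y of L(u), before the shift Pi2. *)
Definition arclen u x : R := (1 + total_energy u)^-1 * (x + energy_upto u x).

Definition arclen_density u x : R := (1 + total_energy u)^-1 * (1 + edens u x).

Lemma total_energy1_gt0 u : 0 < 1 + total_energy u.
Proof. by rewrite ltr_pwDl// total_energy_ge0. Qed.

Lemma edens1_gt0 u x : 0 < 1 + edens u x.
Proof. by rewrite ltr_pwDl// edens_ge0. Qed.

Lemma primitive_arclen u : primitive (arclen u) (arclen_density u).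
Proof. exact/primitiveZ/(primitiveD (primitive_id))/primitive_energy_upto. Qed.

Lemma arclen_density_ge0 u x : 0 <= arclen_density u x.
Proof. by rewrite mulr_ge0 ?invr_ge0 ?ltW ?total_energy1_gt0 ?edens1_gt0. Qed.

Lemma arclenM u x : (1 + total_energy u) * arclen u x = x + energy_upto u x.
Proof. by rewrite /arclen mulVKf// gt_eqF// total_energy1_gt0. Qed.

(** The energy only adds to the length x, so x + E(x) expands distances. This yields strict
    monotonicity of [arclen] and, later, the sup bound on y_v - y_u. *)
Lemma arclen_expand u a b : a <= b -> b - a <= (1 + total_energy u) * (arclen u b - arclen u a).
Proof. by move=> ab; rewrite mulrBr !arclenM; have := energy_upto_homo u ab; lra. Qed.

Lemma arclen_lt u a b : (arclen u a < arclen u b) = (a < b).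
Proof.
have H c d : c < d -> arclen u c < arclen u d.
  move=> cd; have := arclen_expand u (ltW cd); have := total_energy1_gt0 u; nra.
apply/idP/idP; last exact: H.
by apply: contraTT; rewrite -!leNgt le_eqVlt => /predU1P[->//|/H/ltW].
Qed.

Lemma arclen_surj u s : exists x, arclen u x = s.
Proof.
(* The energy up to x has the sign of x, so x + E(x) is at most -c at -c and at least c at c; the
   intermediate value theorem applies on [-c, c]. *)
set c := `|(1 + total_energy u) * s|.
have c0 : 0 <= c by exact: normr_ge0.
have cc : - c <= c by lra.
have ca : continuous (arclen u) := primitive_continuous (primitive_arclen u).
have E1 : arclen u (- c) <= s.
  rewrite -(ler_pM2l (total_energy1_gt0 u)) arclenM.
  have : energy_upto u (- c) <= energy_upto u 0 by apply: energy_upto_homo; lra.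
  by have := ler_norm (- ((1 + total_energy u) * s)); rewrite normrN energy_upto0 -/c; lra.
have E2 : s <= arclen u c.
  rewrite -(ler_pM2l (total_energy1_gt0 u)) arclenM.
  have : energy_upto u 0 <= energy_upto u c by exact: energy_upto_homo.
  by have := ler_norm ((1 + total_energy u) * s); rewrite energy_upto0 -/c; lra.
have [||x _ <-] := @IVT _ (arclen u) (- c) c s cc; last by exists x.
  exact: continuous_subspaceT.
have E3 := le_trans E1 E2.
by rewrite (min_l E3) (max_r E3) E1 E2.
Qed.

(** Verbatim the coordinate y in the definition of [L], for the measure [energy u]. *)
Definition lag_y := locked (fun u s =>
  sup [set z | cumul (energy u : {measure set (measurableTypeR R) -> \bar R}) z + z
               < (1 + fine (energy u `[0, 1[%classic)) * s]).

Lemma lag_yE u s : lag_y u s =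
  sup [set z | cumul (energy u : {measure set (measurableTypeR R) -> \bar R}) z + z
               < (1 + total_energy u) * s].
Proof. by rewrite /lag_y -lock energy_itv01. Qed.

(** Strict monotonicity of [arclen] turns the sublevel set into the half-line below x, whose
    supremum is x. *)
Lemma lag_y_arclen u : cancel (arclen u) (lag_y u).
Proof.
move=> x; rewrite lag_yE.
have -> : [set z | cumul (energy u : {measure set (measurableTypeR R) -> \bar R}) z + z
    < (1 + total_energy u) * arclen u x] = `]-oo, x[%classic.
  apply/seteqP; split=> z /=; rewrite in_itv/= cumul_energy addrC -arclenM ltr_pM2l ?total_energy1_gt0//;
  by rewrite arclen_lt.
by rewrite sup_itv.
Qed.

Lemma arclen_lag_y u : cancel (lag_y u) (arclen u).
Proof. by move=> s; have [x <-] := arclen_surj u s; rewrite lag_y_arclen. Qed.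

Lemma substitution_lag_y u : substitution (arclen u) (arclen_density u) (lag_y u).
Proof.
have homG : {homo arclen u : x z / x <= z} by move=> x z; rewrite !leNgt arclen_lt.
split; [exact: primitive_arclen|exact: arclen_density_ge0|split=> // s t st|].
  by rewrite leNgt -(arclen_lt u) !arclen_lag_y -leNgt.
by split; [exact: arclen_lag_y|exact: lag_y_arclen].
Qed.

Lemma lag_y_homo u : {homo lag_y u : s t / s <= t}.
Proof. by have [_ _ []] := substitution_lag_y u. Qed.

Lemma measurable_lag_y u : measurable_fun setT (lag_y u).
Proof. exact: substitution_measurable (substitution_lag_y u). Qed.

Lemma lag_y0 u : lag_y u 0 = 0.
Proof.
by rewrite -[RHS](lag_y_arclen u) /arclen energy_upto0 addr0 mulr0.
Qed.

Lemma lag_yD1 u s : lag_y u (s + 1) = lag_y u s + 1.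
Proof.
rewrite -[RHS](lag_y_arclen u); congr lag_y; rewrite -{1}[s](arclen_lag_y u) /arclen.
rewrite energy_uptoD1; field; rewrite gt_eqF// total_energy1_gt0//.
Qed.

Lemma lag_y1 u : lag_y u 1 = 1.
Proof. by rewrite -[X in lag_y u X]add0r lag_yD1 lag_y0 add0r. Qed.

Lemma lag_y_itv01 u s : 0 <= s <= 1 -> 0 <= lag_y u s <= 1.
Proof.
move=> /andP[s0 s1]; rewrite -{1}(lag_y0 u) -(lag_y1 u) !lag_y_homo//.
Qed.

(* In terms of these, y_xi = (1 + h) slope(y) and U_xi = (1 + h) slopeU(y). *)
Definition slope u x : R := (1 + edens u x)^-1.

Definition slopeU u x : R := wderiv u x / (1 + edens u x).

Lemma slope_gt0 u x : 0 < slope u x.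
Proof. by rewrite invr_gt0 edens1_gt0. Qed.

Lemma slope_le1 u x : slope u x <= 1.
Proof. by rewrite invf_le1 ?edens1_gt0// lerDl edens_ge0. Qed.

(** A consequence of 2t <= 1 + t^2. The bound holds uniformly in u, although u_x itself may be
    unbounded. *)
Lemma slopeU_le1 u x : `|slopeU u x| <= 1.
Proof.
rewrite normrM normfV (gtr0_norm (edens1_gt0 u x)) ler_pdivrMr ?edens1_gt0// mul1r.
rewrite /edens; have := sqr_ge0 (u x).
rewrite -(real_normK (num_real (wderiv u x))).
have := normr_ge0 (wderiv u x); set t := `|wderiv u x| => t0.
by have : 0 <= (t - 1) ^+ 2 := sqr_ge0 _; nra.
Qed.

Lemma measurable_slope u : measurable_fun setT (slope u).
Proof.
(* Truncation below at 1 makes inversion continuous on the whole line without changing its value at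
   1 + e. *)
have cV : continuous (fun t : R => (Num.max 1 t)^-1).
  move=> t; apply: cvgV; first by rewrite gt_eqF// lt_max ltr01.
  by apply: continuous_max; [exact: cvg_cst|exact: cvg_id].
have -> : slope u = (fun t : R => (Num.max 1 t)^-1) \o (fun x => 1 + edens u x).
  by apply/funext => x; rewrite /slope /= max_r// lerDl edens_ge0.
apply: measurableT_comp; first exact: continuous_measurable_fun.
by apply: measurable_funD => //; exact: measurable_edens.
Qed.

Lemma measurable_slopeU u : measurable_fun setT (slopeU u).
Proof.
by apply: measurable_funM; [exact: measurable_wderiv|exact: measurable_slope].
Qed.

(** The chain rule with F = id: [(1 + h) * slope] is the reciprocal of [arclen_density]. *)
Lemma primitive_lag_y u :
  primitive (lag_y u) (fun s => (1 + total_energy u) * slope u (lag_y u s)).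
Proof.
have := @substitution_primitive _ id _ _ _ (fun x => (1 + total_energy u) * slope u x)
  (substitution_lag_y u); apply.
  by apply: measurable_funM => //; exact: measurable_slope.
have := @primitive_id R; congr primitive; apply/funext => x.
rewrite /slope /arclen_density; field.
by rewrite !gt_eqF ?edens1_gt0 ?total_energy1_gt0.
Qed.

Lemma primitive_lag_U u :
  primitive (u \o lag_y u) (fun s => (1 + total_energy u) * slopeU u (lag_y u s)).
Proof.
have := @substitution_primitive _ u _ _ _ (fun x => (1 + total_energy u) * slopeU u x)
  (substitution_lag_y u); apply.
  by apply: measurable_funM => //; exact: measurable_slopeU.
have := H1_primitive u; congr primitive; apply/funext => x.
rewrite /slopeU /arclen_density; field.
by rewrite !gt_eqF ?edens1_gt0 ?total_energy1_gt0.
Qed.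

End lagrangian_coordinate.

(** * Primitives with bounded density; translations as relabelings *)

Section lipschitz_primitives.
Context {R : realType}.
Local Notation mu := (@lebesgue_measure R).
Implicit Types (F f g : R -> R) (a b c C x : R).

Lemma Lfun_oo_bounded f C : measurable_fun setT f ->
  (\forall x \ae mu, `|f x| <= C) -> f \in Lfun mu +oo%E.
Proof.
move=> mf fC; rewrite inE; apply/andP; split; rewrite inE//=.
rewrite /finite_norm unlock; case: ifPn => // _.
apply: (@le_lt_trans _ _ C%:E); last exact: ltry.
by apply/ess_supP; apply: ae_sub fC => x; rewrite /= lee_fin.
Qed.

Lemma Lloc_oo_bounded f : measurable_fun setT f ->
  (forall a b, exists M, forall x, x \in `[a, b] -> `|f x| <= M) -> Lloc +oo%E f.
Proof.
move=> mf bf a b; have [M fM] := bf a b.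
apply: (@Lfun_oo_bounded _ `|M|); first exact/(measurable_restrictT _ _).1/measurable_funTS.
apply: aeW => x; rewrite patchE; case: ifPn => [|_]; last by rewrite normr0.
by rewrite inE => /fM /le_trans; apply; exact: ler_norm.
Qed.

Lemma Lloc1_bounded g C : measurable_fun setT g -> (forall x, `|g x| <= C) ->
  Lloc 1%:E g.
Proof. by move=> mg gC; exact: Lloc1_le mg gC (Lloc1_cst C). Qed.

Lemma W1loc1_primitive F g : primitive F g -> W1loc 1%:E F.
Proof.
move=> Fg; have cF := primitive_continuous Fg; split=> //.
  exact: Lloc1_continuous.
by exists g; [exact: primitive_weak_deriv|case: Fg].
Qed.

Lemma W1loc_oo_primitive F g C : primitive F g -> (forall x, `|g x| <= C) ->
  W1loc +oo%E F.
Proof.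
move=> Fg gC; have cF := primitive_continuous Fg; split=> //.
  apply: Lloc_oo_bounded; first exact: continuous_measurable_fun.
  by move=> a b; exact: continuous_bounded_itvcc.
exists g; first exact: primitive_weak_deriv.
apply: Lloc_oo_bounded; first exact: Lloc1_measurable Fg.1.
by move=> a b; exists C.
Qed.

Lemma primitive_translation a : primitive (fun x => x + a) (fun=> 1).
Proof. exact: (primitiveDl _ (@primitive_id R)). Qed.

Lemma inverse_cancel f g : cancel f g -> cancel g f -> inverse f = g.
Proof.
move=> fK gK; apply/funext => x; rewrite -{1}[x]gK /inverse pinvKV ?inE//.
by move=> y z _ _; exact: (can_inj fK).
Qed.

Lemma inverse_translation a : inverse (fun x => x + a) = fun x => x - a.
Proof. by apply: inverse_cancel => x; rewrite ?addrK ?subrK. Qed.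

Lemma inG_translation a : inG (fun x => x + a).
Proof.
have W1per_cst c f : f = (fun=> c) -> W1per +oo%E f.
  move=> ->; split=> //.
  by apply: (W1loc_oo_primitive (primitive_cst c) (C := 0)) => x; rewrite normr0.
split.
- by exists (fun x => x - a) => x; rewrite ?addrK ?subrK.
- by apply: (W1loc_oo_primitive (primitive_translation a) (C := 1)) => x; rewrite normr1.
- by move=> x; rewrite addrAC.
- by apply: (W1per_cst a); apply/funext => x /=; rewrite addrAC subrr add0r.
- apply: (W1per_cst (- a)); apply/funext => x; rewrite inverse_translation /=.
  by rewrite addrAC subrr add0r.
Qed.

End lipschitz_primitives.

(** * The Lagrangian triple of an energy measure *)

Section lagrangian_triple.
Context {R : realType}.
Local Notation mu := (@lebesgue_measure R).
Implicit Types (u v : H1per R) (a b c x s : R).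

(** The triple to which [L] applies [Pi] when the measure is [energy u]. *)
Definition lag0 u : lagr R :=
  Lagr (lag_y u) (u \o lag_y u) (fun s => 1 + total_energy u - wderiv (lag_y u) s).

Lemma wderiv_lag_y u :
  \forall s \ae mu, wderiv (lag_y u) s = (1 + total_energy u) * slope u (lag_y u s).
Proof. exact: wderiv_ae (primitive_lag_y u). Qed.

Lemma norm01_1 (f : R -> R) :
  norm01 1%:E f = (\int[mu]_(x in `[0%R, 1%R]) `|(f x)%:E|)%E.
Proof.
rewrite /norm01 Lnorm1 [RHS]integral_mkcond; apply: eq_integral => x _ /=.
by rewrite !patchE; case: ifP => // _; rewrite normr0.
Qed.

Lemma norm01_1E (f : R -> R) : Lloc 1%:E f ->
  norm01 1%:E f = (\int[mu]_(x in `[0, 1]) `|f x|)%:E.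
Proof.
move=> Lf; rewrite norm01_1 /Rintegral fineK//.
apply: integrable_fin_num => //; exact: (Lloc1_itvcc 0 1 (Lloc1_norm Lf)).
Qed.

(** As [slope] is at most 1, nu is nonnegative almost everywhere, so its L^1 norm is its integral (1
    + h) - (y(1) - y(0)) = h. *)
Lemma lagr_h_lag0 u : lagr_h (lag0 u) = total_energy u.
Proof.
have Pw := primitive_wderiv (primitive_lag_y u).
have Lnu : Lloc 1%:E (lnu (lag0 u)) by apply: Lloc1B (Lloc1_cst _) Pw.1.
rewrite /lagr_h norm01_1E//=.
transitivity (\int[mu]_(s in `[0, 1]) (1 + total_energy u - wderiv (lag_y u) s)).
  apply: eq_ae_Rintegral => //.
  - by apply: measurableT_comp => //; exact: Lloc1_measurable Lnu.
  - exact: Lloc1_measurable Lnu.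
  - apply: ae_sub (wderiv_lag_y u) => s ->; rewrite ger0_norm// subr_ge0.
    by rewrite ler_piMr ?slope_le1// ltW// total_energy1_gt0.
rewrite RintegralB_itvcc; [|exact: Lloc1_cst|exact: Pw.1].
by rewrite Pw.2// lag_y1 lag_y0 Rintegral_cst_itvcc//; ring.
Qed.

Definition lag_shift := locked (fun u => \int[mu]_(s in `[0, 1]) lag_y u s).

(** The explicit value of [L] on the energy measure. The factor [wderiv id] is left over from
    relabeling by the identity in [Pi1]; it is known to be 1 only almost everywhere. *)
Definition lagL u : lagr R :=
  let a := lag_shift u in
  Lagr (fun s => lag_y u (s - a)) (fun s => u (lag_y u (s - a)))
    (fun s => (1 + total_energy u - wderiv (lag_y u) (s - a)) * wderiv id (s - a)).

End lagrangian_triple.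

(** * The value of L and its membership in F *)

Section lagrangian_image.
Context {R : realType}.
Local Notation mu := (@lebesgue_measure R).
Local Notation measureR := {measure set (measurableTypeR R) -> \bar R}.
Implicit Types (u v : H1per R) (a b c x s : R).

Lemma oriented_integralE (F g : R -> R) x : primitive F g ->
  oriented_integral g 0 x = F x - F 0.
Proof.
move=> [_ Fg]; rewrite /oriented_integral; case: leP => [x0|/ltW x0].
  by rewrite Fg.
by rewrite Fg// opprB.
Qed.

Lemma primitive_lag0_nu u :
  primitive (fun s => (1 + total_energy u) * s - lag_y u s) (lnu (lag0 u)).
Proof.
have := primitiveB (primitiveZ (1 + total_energy u) (@primitive_id R))
  (primitive_wderiv (primitive_lag_y u)).
by congr primitive; apply/funext => s /=; rewrite mulr1.
Qed.

(** The primitive of nu vanishing at 0 is (1 + h) xi - y(xi), so the relabeling function of [Pi1] is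
    already the identity. *)
Lemma Pi1_lag0 u : Pi1 (lag0 u) = relabel (lag0 u) id.
Proof.
rewrite /Pi1 lagr_h_lag0; congr relabel.
have -> : (fun xi => (1 + total_energy u)^-1 *
    (ly (lag0 u) xi + oriented_integral (lnu (lag0 u)) 0 xi)) = id.
  apply/funext => s; rewrite (oriented_integralE s (primitive_lag0_nu u)) /= lag_y0.
  by field; rewrite gt_eqF// total_energy1_gt0.
exact: inverse_cancel.
Qed.

Lemma L_lagr u (m : measureR) (h : R) (y : R -> R) : fine (m `[0, 1[%classic) = h ->
  (fun s => sup [set z | cumul m z + z < (1 + h) * s]) = y ->
  L u m = Pi (Lagr y (u \o y) (fun s => 1 + h - wderiv y s)).
Proof. by rewrite /L => -> ->. Qed.

Lemma L_embed u : L u (energy u : measureR) = lagL u.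
Proof.
transitivity (Pi (lag0 u)).
  by apply: L_lagr; [exact: energy_itv01|apply/funext => s; rewrite lag_yE].
by rewrite /Pi Pi1_lag0 /lagL /lag_shift -lock.
Qed.

(** No null set has to be translated: both sides are densities of the shifted F. *)
Lemma wderiv_shift_ae (F g : R -> R) c : primitive F g ->
  \forall x \ae mu, wderiv F (x - c) = g (x - c).
Proof.
move=> Fg; have := primitive_shift (- c) Fg.
exact: (primitive_ae_unique (primitive_shift (- c) (primitive_wderiv Fg))).
Qed.

Lemma measurable_shift (f : R -> R) c : measurable_fun setT f ->
  measurable_fun setT (fun x => f (x - c)).
Proof.
by move=> mf; apply: (measurableT_comp mf); exact: measurable_funD.
Qed.

Lemma lagL_nu_ae u : \forall s \ae mu,
  lnu (lagL u) s =
  (1 + total_energy u) * (1 - slope u (lag_y u (s - lag_shift u))).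
Proof.
have A1 := wderiv_shift_ae (lag_shift u) (primitive_lag_y u).
have A2 := wderiv_shift_ae (lag_shift u) (@primitive_id R).
apply: ae_sub (ae_and A1 A2) => s [/= -> ->]; ring.
Qed.

Lemma measurable_lagL_nu u : measurable_fun setT (lnu (lagL u)).
Proof.
apply: measurable_funM.
  by apply: measurable_funB => //; apply: measurable_shift; exact: measurable_wderiv.
by apply: measurable_shift; exact: measurable_wderiv.
Qed.

Lemma lag_slope_bounds u s :
  0 <= (1 + total_energy u) * slope u s <= 1 + total_energy u.
Proof.
have h := ltW (total_energy1_gt0 u); have s0 := ltW (slope_gt0 u s).
by rewrite mulr_ge0//= ler_piMr ?slope_le1.
Qed.

Lemma lag_slopeU_bound u s :
  `|(1 + total_energy u) * slopeU u s| <= 1 + total_energy u.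
Proof.
have h := total_energy1_gt0 u.
by rewrite normrM (gtr0_norm h) ler_piMr ?slopeU_le1// ltW.
Qed.

Lemma inF_lagL u : inF (lagL u).
Proof.
have h := total_energy1_gt0 u; set a := lag_shift u.
have Py := primitive_shift (- a) (primitive_lag_y u).
have PU := primitive_shift (- a) (primitive_lag_U u).
have yD1 x : lag_y u (x + 1 - a) = lag_y u (x - a) + 1.
  by rewrite addrAC lag_yD1.
have mnu := measurable_lagL_nu u.
have nuB : \forall s \ae mu, 0 <= lnu (lagL u) s <= 1 + total_energy u.
  apply: ae_sub (lagL_nu_ae u) => s ->.
  have := lag_slope_bounds u (lag_y u (s - lag_shift u)).
  by rewrite mulrBr mulr1 lerBlDr lerDl subr_ge0 andbC.
have nuB' : \forall s \ae mu, `|lnu (lagL u) s| <= 1 + total_energy u.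
  by apply: ae_sub nuB => s /andP[p q]; rewrite ger0_norm.
have Lnu : Lloc 1%:E (lnu (lagL u)).
  apply: (Lloc1_ae mnu _ (lagL_nu_ae u)).
  apply: (@Lloc1_bounded _ _ (1 + total_energy u)) => [|s].
    apply: measurable_funM => //; apply: measurable_funB => //.
    apply: (measurableT_comp (measurable_slope u)); apply: measurable_shift.
    exact: measurable_lag_y.
  have /andP[s0 s1] := lag_slope_bounds u (lag_y u (s - a)).
  by rewrite mulrBr mulr1 ger0_norm; lra.
have wy : \forall s \ae mu, wderiv (ly (lagL u)) s =
    (1 + total_energy u) * slope u (lag_y u (s - a)) := wderiv_ae Py.
have wU : \forall s \ae mu, wderiv (lU (lagL u)) s =
    (1 + total_energy u) * slopeU u (lag_y u (s - a)) := wderiv_ae PU.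
have pu := (H1funP u).2.
rewrite (_ : lagL u = Lagr (ly (lagL u)) (lU (lagL u)) (lnu (lagL u)))//.
split.
- split.
  + by split; [exact: W1loc1_primitive Py|exists 1 => x /=; rewrite yD1].
  + by split; [exact: W1loc1_primitive PU|move=> x /=; rewrite yD1 pu].
  + split=> //=.
    (* For the periodicity of nu: y(. - a) + 1 is y(. + 1 - a), so y_xi and its translate are
       densities of one function. The leftover factor [wderiv id] is 1 almost everywhere at both
       points. *)
    have P1 := primitive_shift (- a) (primitive_wderiv (primitive_lag_y u)).
    have P1' := primitiveDl 1 P1.
    have P2 := primitive_shift 1 P1.
    have E1 : (fun x => lag_y u (x - a) + 1) = (fun x => lag_y u (x + 1 - a)).
      by apply/funext => x; rewrite yD1.
    rewrite E1 in P1'.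
    have W1 := primitive_ae_unique P1' P2.
    have W2 := wderiv_shift_ae a (@primitive_id R).
    have W3 := wderiv_shift_ae (a - 1) (@primitive_id R).
    apply: ae_sub (ae_and W1 (ae_and W2 W3)) => x [-> [->]].
    by rewrite opprB addrA addrAC -addrA => ->.
- by split; [exact: W1loc1_primitive Py|move=> x /=; rewrite yD1].
- split.
    apply: (W1loc_oo_primitive Py (C := 1 + total_energy u)) => s.
    by have /andP[s0 s1] := lag_slope_bounds u (lag_y u (s - a)); rewrite ger0_norm.
  apply: (W1loc_oo_primitive PU (C := 1 + total_energy u)) => s.
  exact: lag_slopeU_bound.
- exact: Lfun_oo_bounded mnu nuB'.
- split.
  + apply: ae_sub wy => s ->.
    by have /andP[] := lag_slope_bounds u (lag_y u (s - a)).
  + by apply: ae_sub nuB => s /andP[].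
  + exists (1 + total_energy u) => //.
    apply: ae_sub (ae_and wy (lagL_nu_ae u)) => s [-> ->].
    by rewrite -/a; lra.
  + apply: ae_sub (ae_and wy (ae_and wU (lagL_nu_ae u))) => s [-> [-> ->]].
    (* With q the slope and e the energy density at z, 1 - q = q e, so both sides equal (1 + h)^2
       q^2 e. *)
    rewrite -/a /= /slope /slopeU; set z := lag_y u (s - a).
    have := edens1_gt0 u z; rewrite /edens => z0.
    by field; rewrite gt_eqF.
Qed.

End lagrangian_image.

(** * Continuity *)

Section distance_bound.
Context {R : realType}.
Local Notation mu := (@lebesgue_measure R).
Local Notation measureR := {measure set (measurableTypeR R) -> \bar R}.
Implicit Types (u v : H1per R) (a b c x s : R).

Lemma norm01_oo_le (f : R -> R) (M : R) : 0 <= M ->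
  (forall x, x \in `[0, 1] -> `|f x| <= M) -> (norm01 +oo%E f <= M%:E)%E.
Proof.
move=> M0 fM; rewrite /norm01 unlock; case: ifPn => _; last by rewrite lee_fin.
apply/ess_supP; apply: aeW => x /=; rewrite patchE; case: ifPn => [|_].
  by rewrite inE/= => /fM; rewrite lee_fin.
by rewrite normr0 lee_fin.
Qed.

Lemma norm01_1_ae (f g : R -> R) : measurable_fun setT f -> Lloc 1%:E g ->
  (\forall x \ae mu, f x = g x) ->
  norm01 1%:E f = (\int[mu]_(x in `[0, 1]) `|g x|)%:E.
Proof.
move=> mf Lg fg; rewrite norm01_1E; last exact: Lloc1_ae fg.
congr EFin; apply: eq_ae_Rintegral => //.
- exact: measurableT_comp.
- exact: Lloc1_measurable (Lloc1_norm Lg).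
- by apply: ae_sub fg => x ->.
Qed.

Lemma normV_le (F g : R -> R) (M : R) : 0 <= M -> primitive F g ->
  (forall x, x \in `[0, 1] -> `|F x| <= M) ->
  (normV F <= (M + \int[mu]_(x in `[0, 1]) `|g x|)%:E)%E.
Proof.
move=> M0 Fg FM; rewrite /normV EFinD leeD//; first exact: norm01_oo_le.
rewrite (norm01_1_ae _ Fg.1)//; first exact: measurable_wderiv.
exact: wderiv_ae.
Qed.

Lemma normE_ge0 (X : lagr R) : (0 <= normE X)%E.
Proof. by rewrite /normE /normV !adde_ge0//; exact: Lnorm_ge0. Qed.

Lemma J_ge0 (X Y : lagr R) : (0 <= J X Y)%E.
Proof.
by apply: le_ereal_inf_tmp => _ [f [g [_ _ ->]]]; exact: normE_ge0.
Qed.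

Lemma dF_ge0 (X Y : lagr R) : (0 <= dF X Y)%E.
Proof.
apply: le_ereal_inf_tmp => _ [N [S [_ _ _ ->]]].
by apply: sume_ge0 => i _; exact: J_ge0.
Qed.

Lemma dF_le_J (X Y : lagr R) : inF X -> inF Y -> (dF X Y <= J X Y)%E.
Proof.
move=> FX FY; apply: ereal_inf_lbound; exists 1%N, (fun n => if n is 0%N then X else Y).
by split=> [[|n]||| ]//; rewrite big_ord_recl big_ord0 adde0.
Qed.

Lemma J_le (X Y X' Y' : lagr R) f g : inG f -> inG g ->
  relabel X f = X' -> relabel Y g = Y' -> (J X Y <= normE (lsub X' Y'))%E.
Proof. by move=> Gf Gg <- <-; apply: ereal_inf_lbound; exists f, g. Qed.

(** The third component of [lagL u] once the shift is undone. Each [wderiv] factor of an identity or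
    a translation equals 1 almost everywhere. *)
Definition relabeled_nu u s : R :=
  (1 + total_energy u - wderiv (lag_y u) s) * wderiv id s
  * wderiv (fun x => x + lag_shift u) s.

Lemma relabel_lagL u : relabel (lagL u) (fun x => x + lag_shift u) =
  Lagr (lag_y u) (u \o lag_y u) (relabeled_nu u).
Proof.
by rewrite /relabel /lagL/=; congr Lagr; apply/funext => s /=; rewrite addrK.
Qed.

Lemma relabeled_nu_ae u : \forall s \ae mu,
  relabeled_nu u s = (1 + total_energy u) * (1 - slope u (lag_y u s)).
Proof.
have A1 := wderiv_lag_y u; have A2 := wderiv_ae (@primitive_id R).
have A3 := wderiv_ae (primitive_translation (lag_shift u)).
apply: ae_sub (ae_and A1 (ae_and A2 A3)) => s [E1 [E2 E3]].
by rewrite /relabeled_nu E1 E2 E3; ring.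
Qed.

Lemma measurable_relabeled_nu u : measurable_fun setT (relabeled_nu u).
Proof.
apply: measurable_funM; last exact: measurable_wderiv.
apply: measurable_funM; last exact: measurable_wderiv.
by apply: measurable_funB => //; exact: measurable_wderiv.
Qed.

Lemma ae_eqB (f f' g g' : R -> R) : (\forall x \ae mu, f x = f' x) ->
  (\forall x \ae mu, g x = g' x) -> \forall x \ae mu, f x - g x = f' x - g' x.
Proof. by move=> ff' gg'; apply: ae_sub (ae_and ff' gg') => x [-> ->]. Qed.

Definition dslope v u s : R :=
  (1 + total_energy v) * slope v (lag_y v s) - (1 + total_energy u) * slope u (lag_y u s).

Definition dslopeU v u s : R :=
  (1 + total_energy v) * slopeU v (lag_y v s) - (1 + total_energy u) * slopeU u (lag_y u s).

Lemma primitive_dslope v u : primitive (lag_y v \- lag_y u) (dslope v u).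
Proof. exact: (primitiveB (primitive_lag_y v) (primitive_lag_y u)). Qed.

Lemma primitive_dslopeU v u :
  primitive ((v \o lag_y v) \- (u \o lag_y u)) (dslopeU v u).
Proof. exact: (primitiveB (primitive_lag_U v) (primitive_lag_U u)). Qed.

Lemma normE_lsub (y U n y' U' n' : R -> R) :
  normE (lsub (Lagr y U n) (Lagr y' U' n')) =
  (normV (y \- y')%R + normV (U \- U')%R + norm01 1%:E (n \- n')%R)%E.
Proof. by []. Qed.

(** A one-step chain and a single pair of translations bound the distance. Since nu = 1 + h - y_xi,
    the third component costs the difference of the total energies and a second copy of the integral
    of [dslope], hence the factor 2. *)
Lemma dD_embed_le v u (M1 M2 : R) : 0 <= M1 -> 0 <= M2 ->
  (forall s, s \in `[0, 1] -> `|lag_y v s - lag_y u s| <= M1) ->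
  (forall s, s \in `[0, 1] -> `|v (lag_y v s) - u (lag_y u s)| <= M2) ->
  (dD (embed v) (embed u) <= (M1 + M2 + `|total_energy v - total_energy u|
     + 2 * \int[mu]_(s in `[0, 1]) `|dslope v u s|
     + \int[mu]_(s in `[0, 1]) `|dslopeU v u s|)%:E)%E.
Proof.
move=> M10 M20 yM UM; rewrite /dD /embed/= !L_embed.
apply: (le_trans (dF_le_J (inF_lagL v) (inF_lagL u))).
apply: (@le_trans _ _ (normE (lsub (Lagr (lag_y v) (v \o lag_y v) (relabeled_nu v))
    (Lagr (lag_y u) (u \o lag_y u) (relabeled_nu u))))).
  exact: J_le (inG_translation _) (inG_translation _) (relabel_lagL v) (relabel_lagL u).
have Ld := (primitive_dslope v u).1.
have nu_ae : \forall s \ae mu, relabeled_nu v s - relabeled_nu u s =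
    total_energy v - total_energy u - dslope v u s.
  apply: ae_sub (ae_eqB (relabeled_nu_ae v) (relabeled_nu_ae u)) => s E.
  apply: (eq_trans E); rewrite /dslope.
  move: (total_energy v) (total_energy u) (slope v _) (slope u _) => a b c d.
  by ring.
have mnu : measurable_fun setT (relabeled_nu v \- relabeled_nu u).
  by apply: measurable_funB; exact: measurable_relabeled_nu.
rewrite normE_lsub.
have V1 := normV_le M10 (primitive_dslope v u) yM.
have V2 := normV_le M20 (primitive_dslopeU v u) UM.
rewrite (norm01_1_ae mnu _ nu_ae); last exact: Lloc1B (Lloc1_cst _) Ld.
apply: (le_trans (leeD (leeD V1 V2) (lexx _))).
rewrite -!EFinD lee_fin.
move: (dslope v u) (total_energy v - total_energy u) Ld => d t Ld.
have : \int[mu]_(x in `[0, 1]) `|t - d x| <=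
    `|t| + \int[mu]_(s in `[0, 1]) `|d s|.
  have -> : `|t| =
      \int[mu]_(x in `[0, 1]) `|t|.
    by rewrite Rintegral_cst_itvcc// subr0 mulr1.
  rewrite -RintegralD_itvcc; [|exact: Lloc1_cst|exact: Lloc1_norm].
  apply: le_Rintegral => //.
  - apply/Lloc1_itvcc/Lloc1_norm; exact: Lloc1B (Lloc1_cst _) Ld.
  - apply/Lloc1_itvcc/Lloc1D; [exact: Lloc1_cst|exact: Lloc1_norm].
  - by move=> x _; exact: ler_normB.
lra.
Qed.

End distance_bound.

(** * Uniform continuity near a compact interval *)

Section uniform_continuity.
Context {R : realType}.
Implicit Types (f : R -> R) (a b e x z : R).

(** Only x has to lie in [a, b]; z may leave it. *)
Lemma uniform_modulus f a b e : continuous f -> 0 < e ->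
  exists2 d : R, 0 < d &
    forall x z, x \in `[a, b] -> `|z - x| < d -> `|f z - f x| < e.
Proof.
move=> cf e0.
have cab : compact `[a, b]%classic := @segment_compact _ a b.
have : \forall d \near (0 : R)^'+, `[a, b]%classic `<=`
    [set x | forall z, `|z - x| < d -> `|f z - f x| < e].
  apply: (compact_near_coveringP _).1 => // x _.
  have [d d0 H] := continuous_modulus x cf (divr_gt0 e0 (ltr0Sn R 1)).
  have d20 : 0 < d / 2 by rewrite divr_gt0.
  exists ([set y | `|y - x| < d / 2], [set r | r < d / 2]) => /=.
    split; last exact: nbhs_right_lt.
    by exists (d / 2) => //= y /=; rewrite distrC.
  move=> [y r] /= [yx rd] z zy.
  have zx : `|z - x| < d.
    have -> : z - x = (z - y) + (y - x) by ring.
    rewrite (le_lt_trans (ler_normD _ _))//; lra.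
  have := H _ zx; have := H y ltac:(lra) => h1 h2.
  have -> : f z - f y = (f z - f x) - (f y - f x) by ring.
  rewrite (le_lt_trans (ler_normB _ _))//; lra.
move=> H; near (0 : R)^'+ => d; exists d => // x z xab; have : `[a, b]%classic `<=`
    [set x | forall z, `|z - x| < d -> `|f z - f x| < e] by near: d.
by apply.
Unshelve. all: by end_near. Qed.

End uniform_continuity.

(** * Estimates in terms of the energy densities *)

Section estimates.
Context {R : realType}.
Local Notation mu := (@lebesgue_measure R).
Implicit Types (u v : H1per R) (a b c x s r t : R).

Definition dist_edens := locked (fun v u =>
  \int[mu]_(x in `[0, 1]) `|edens v x - edens u x|).

Lemma dist_edensE v u :
  dist_edens v u = \int[mu]_(x in `[0, 1]) `|edens v x - edens u x|.
Proof. by rewrite /dist_edens -lock. Qed.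

(** The square of [H1norm (v \- u)], with [wderiv (v \- u)] replaced by the difference of the
    derivatives, which agrees with it almost everywhere. *)
Definition dist_sqr := locked (fun v u => \int[mu]_(x in `[0, 1])
  ((v x - u x) ^+ 2 + (wderiv v x - wderiv u x) ^+ 2)).

Lemma dist_sqrE v u : dist_sqr v u = \int[mu]_(x in `[0, 1])
  ((v x - u x) ^+ 2 + (wderiv v x - wderiv u x) ^+ 2).
Proof. by rewrite /dist_sqr -lock. Qed.

Lemma sqrB_le a b : (a - b) ^+ 2 <= 2 * (a ^+ 2 + b ^+ 2).
Proof. have := sqr_ge0 (a + b); nra. Qed.

Lemma Lloc1_dist_sqr v u : Lloc 1%:E
  (fun x => (v x - u x) ^+ 2 + (wderiv v x - wderiv u x) ^+ 2).
Proof.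
apply: Lloc1D.
  apply: Lloc1_continuous => x.
  have cvu : continuous (fun x => v x - u x).
    by move=> z; apply: cvgB; exact: H1_continuous.
  by apply: (@continuousM _ _ (fun x => v x - u x) (fun x => v x - u x)); exact: cvu.
have L : Lloc 1%:E (fun x => 2 * (wderiv v x ^+ 2 + wderiv u x ^+ 2)).
  by apply/Lloc1Z/Lloc1D; exact: H1_wderiv_sqr.
apply: Lloc1_le L.
  by apply: measurable_funX; apply: measurable_funB; exact: measurable_wderiv.
by move=> x; rewrite ger0_norm ?sqr_ge0// sqrB_le.
Qed.

Lemma H1norm_dist v u : H1norm (v \- u) = Num.sqrt (dist_sqr v u).
Proof.
rewrite dist_sqrE; congr Num.sqrt; apply: eq_ae_Rintegral => //.
- apply: measurable_funD; apply: measurable_funX; last exact: measurable_wderiv.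
  by apply: measurable_funB; apply: continuous_measurable_fun; exact: H1_continuous.
- exact: Lloc1_measurable (Lloc1_dist_sqr v u).
- have := wderiv_ae (primitiveB (H1_primitive v) (H1_primitive u)).
  by apply: ae_sub => x ->.
Qed.

Lemma dist_sqr_ge0 v u : 0 <= dist_sqr v u.
Proof. by rewrite dist_sqrE; apply: Rintegral_ge0 => x _; rewrite addr_ge0// sqr_ge0. Qed.

Lemma dist_sqr_lt v u r : 0 < r -> H1norm (v \- u) < r -> dist_sqr v u < r ^+ 2.
Proof.
move=> r0; rewrite H1norm_dist => h.
by rewrite -(sqr_sqrtr (dist_sqr_ge0 v u)) ltrXn2r// ?sqrtr_ge0 ?ltW.
Qed.

(* AM-GM replaces the Cauchy-Schwarz inequality:
   [2 |a - b| |b| <= (a - b)^2 / t + t b^2]. *)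
Lemma sqr_dist_le a b t : 0 < t ->
  `|a ^+ 2 - b ^+ 2| <= (1 + t^-1) * (a - b) ^+ 2 + t * b ^+ 2.
Proof.
move=> t0; have ti : 0 <= t^-1 by rewrite invr_ge0 ltW.
have E c : 0 <= t^-1 * (a - b) ^+ 2 + 2 * c * (a - b) * b + c ^+ 2 * t * b ^+ 2.
  have -> : t^-1 * (a - b) ^+ 2 + 2 * c * (a - b) * b + c ^+ 2 * t * b ^+ 2 =
      t^-1 * (a - b + c * t * b) ^+ 2 by field; rewrite gt_eqF.
  by rewrite mulr_ge0 ?sqr_ge0.
move: (E 1) (E (-1)) (sqr_ge0 (a - b)) => E1 E2 E3.
rewrite (mulrDl 1 t^-1); move: (t^-1 * (a - b) ^+ 2) E1 E2 => q E1 E2.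
by rewrite ler_norml; apply/andP; split; lra.
Qed.

Lemma Rintegral_mono (f g : R -> R) a b : Lloc 1%:E f -> Lloc 1%:E g ->
  (forall x, x \in `[a, b] -> f x <= g x) ->
  \int[mu]_(x in `[a, b]) f x <= \int[mu]_(x in `[a, b]) g x.
Proof. by move=> Lf Lg fg; apply: le_Rintegral => //; exact: Lloc1_itvcc. Qed.

Lemma Lloc1_dist_edens v u : Lloc 1%:E (fun x => `|edens v x - edens u x|).
Proof. by apply: Lloc1_norm; apply: Lloc1B; exact: Lloc1_edens. Qed.

Lemma dist_edens_le v u t : 0 < t ->
  dist_edens v u <= (1 + t^-1) * dist_sqr v u + t * total_energy u.
Proof.
move=> t0; rewrite dist_edensE dist_sqrE total_energyE.
have Ld := Lloc1_dist_sqr v u; have Le := Lloc1_edens u.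
rewrite -(RintegralZl_itvcc _ _ _ Ld) -(RintegralZl_itvcc _ _ _ Le).
rewrite -RintegralD_itvcc; [|exact: Lloc1Z|exact: Lloc1Z].
apply: Rintegral_mono; first exact: Lloc1_dist_edens.
  by apply: Lloc1D; exact: Lloc1Z.
move=> x _; rewrite /edens.
have := sqr_dist_le (v x) (u x) t0; have := sqr_dist_le (wderiv v x) (wderiv u x) t0.
move: (v x) (u x) (wderiv v x) (wderiv u x) => a b c d.
have -> : a ^+ 2 + c ^+ 2 - (b ^+ 2 + d ^+ 2) = (a ^+ 2 - b ^+ 2) + (c ^+ 2 - d ^+ 2).
  by ring.
have := ler_normD (a ^+ 2 - b ^+ 2) (c ^+ 2 - d ^+ 2).
rewrite (mulrDr _ ((a - b) ^+ 2)) (mulrDr t); lra.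
Qed.

Lemma total_energy_dist v u : `|total_energy v - total_energy u| <= dist_edens v u.
Proof.
have Lv := Lloc1_edens v; have Lu := Lloc1_edens u.
rewrite !total_energyE dist_edensE -RintegralB_itvcc//.
apply: le_normr_Rintegral_itvcc => //; first exact: Lloc1B.
exact: Lloc1_dist_edens.
Qed.

Lemma energy_upto_dist v u x : 0 <= x <= 1 ->
  `|energy_upto v x - energy_upto u x| <= dist_edens v u.
Proof.
move=> /andP[x0 x1]; have Lv := Lloc1_edens v; have Lu := Lloc1_edens u.
have E w : energy_upto w x = \int[mu]_(x in `[0, x]) edens w x.
  by rewrite (primitive_energy_upto w).2// energy_upto0 subr0.
rewrite !E dist_edensE -RintegralB_itvcc//.
apply: le_trans (Rintegral_itvcc_subset (Lloc1_dist_edens v u) _ (lexx 0) x1) => //.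
apply: le_normr_Rintegral_itvcc => //; first exact: Lloc1B.
exact: Lloc1_dist_edens.
Qed.

(** With Y = y_v(s) and E the energy from 0, (1 + h_v) s = Y + E_v(Y). The left side is thus E_u(Y)
    - E_v(Y) + (h_v - h_u) s, and each part is at most [dist_edens v u]. *)
Lemma arclen_dist v u s : 0 <= s <= 1 ->
  `|(1 + total_energy u) * (arclen u (lag_y v s) - s)| <= 2 * dist_edens v u.
Proof.
move=> s01; have := energy_upto_dist v u (lag_y_itv01 v s01).
have := total_energy_dist v u.
have E2 : (1 + total_energy v) * s = lag_y v s + energy_upto v (lag_y v s).
  by rewrite -arclenM (arclen_lag_y v s).
move: (arclenM u (lag_y v s)) E2; case/andP: s01.
move: (dist_edens v u) (total_energy v) (total_energy u) (lag_y v s) => k hv hu Y.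
move: (energy_upto v Y) (energy_upto u Y) (arclen u Y) => Ev Eu A s0 s1 E1 E2.
rewrite mulrBr E1 => /ler_normlP[h1 h2] /ler_normlP[h3 h4].
by apply/ler_normlP; split; nra.
Qed.

Lemma arclen_dist1 v u s : 0 <= s <= 1 ->
  `|arclen u (lag_y v s) - s| <= 2 * dist_edens v u.
Proof.
move=> /(arclen_dist v u); apply: le_trans.
by rewrite normrM ler_peMl// ger0_norm ?lerDl ?addr_ge0 ?total_energy_ge0.
Qed.

Lemma arclen_expand_norm u a b :
  `|a - b| <= `|(1 + total_energy u) * (arclen u a - arclen u b)|.
Proof.
have h := total_energy1_gt0 u.
have H c d : c <= d -> `|d - c| <= `|(1 + total_energy u) * (arclen u d - arclen u c)|.
  move=> cd; have := arclen_expand u cd; rewrite (ger0_norm (x := d - c)) ?subr_ge0//.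
  by move=> /le_trans; apply; exact: ler_norm.
have [ab|/ltW ba] := leP b a; first exact: H.
by rewrite distrC normrM [X in _ * X]distrC -normrM H.
Qed.

Lemma lag_y_dist v u s : 0 <= s <= 1 ->
  `|lag_y v s - lag_y u s| <= 2 * dist_edens v u.
Proof.
move=> s01; apply: le_trans (arclen_dist v u s01).
have := arclen_expand_norm u (lag_y v s) (lag_y u s).
by rewrite (arclen_lag_y u s).
Qed.

End estimates.

(** * Consequences of closeness in H^1 *)

Section convergence.
Context {R : realType}.
Local Notation mu := (@lebesgue_measure R).
Implicit Types (u v : H1per R) (a b c e x s r t : R).

Definition dist_wderiv := locked (fun v u : H1per R =>
  \int[mu]_(x in `[0, 1]) `|wderiv v x - wderiv u x|).

Lemma dist_wderivE v u :
  dist_wderiv v u = \int[mu]_(x in `[0, 1]) `|wderiv v x - wderiv u x|.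
Proof. by rewrite /dist_wderiv -lock. Qed.

Lemma Lloc1_dist_wderiv v u : Lloc 1%:E (fun x => `|wderiv v x - wderiv u x|).
Proof.
by apply: Lloc1_norm; apply: Lloc1B; [exact: (H1_primitive v).1|exact: (H1_primitive u).1].
Qed.

(** The weights are tuned so that a mean square of at most r^2 gives a mean of at most r/2 + r/2, as
    Cauchy-Schwarz would. *)
Lemma norm_le_mean a r : 0 < r -> `|a| <= 2^-1 * r + (2 * r)^-1 * a ^+ 2.
Proof.
move=> r0; rewrite -(real_normK (num_real a)); move: `|a| => b.
have -> : 2^-1 * r + (2 * r)^-1 * b ^+ 2 = (2 * r)^-1 * (r - b) ^+ 2 + b.
  by field; rewrite gt_eqF.
by rewrite lerDr mulr_ge0 ?sqr_ge0// invr_ge0 mulr_ge0// ltW.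
Qed.

Lemma dist_wderiv_le v u r : 0 < r -> dist_sqr v u <= r ^+ 2 -> dist_wderiv v u <= r.
Proof.
move=> r0 vur; rewrite dist_wderivE; have Ld := Lloc1_dist_sqr v u.
apply: (@le_trans _ _ (2^-1 * r + (2 * r)^-1 * dist_sqr v u)).
  have -> : 2^-1 * r = \int[mu]_(x in `[0, 1]) (2^-1 * r).
    by rewrite Rintegral_cst_itvcc// subr0 mulr1.
  rewrite dist_sqrE -RintegralZl_itvcc// -RintegralD_itvcc; last exact: Lloc1Z.
    apply: Rintegral_mono; first exact: Lloc1_dist_wderiv.
      by apply: Lloc1D; [exact: Lloc1_cst|exact: Lloc1Z].
    move=> x _; apply: (le_trans (norm_le_mean _ r0)).
    rewrite lerD2l ler_wpM2l ?lerDr ?sqr_ge0// invr_ge0 mulr_ge0// ltW//.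
  exact: Lloc1_cst.
move: (dist_sqr v u) vur => E Er; have r20 : 0 < 2 * r by rewrite mulr_gt0.
have : (2 * r)^-1 * E <= (2 * r)^-1 * r ^+ 2 by rewrite ler_pM2l ?invr_gt0.
have -> : (2 * r)^-1 * r ^+ 2 = 2^-1 * r by field; rewrite gt_eqF.
lra.
Qed.

(** Somewhere |v - u| < r, since otherwise the mean square would be at least r^2; from there v - u
    varies by at most the integral of |v_x - u_x|, which is at most r. *)
Lemma sup_dist v u r x : 0 < r -> dist_sqr v u < r ^+ 2 -> x \in `[0, 1] ->
  `|v x - u x| <= 2 * r.
Proof.
move=> r0 vur x01; have Ld := Lloc1_dist_sqr v u.
have [z z01 zr] : exists2 z, z \in `[0, 1] & `|v z - u z| < r.
  apply: contrapT => H; move: vur; apply/negP; rewrite -leNgt.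
  have -> : r ^+ 2 = \int[mu]_(x in `[0, 1]) (r ^+ 2).
    by rewrite Rintegral_cst_itvcc// subr0 mulr1.
  rewrite dist_sqrE; apply: Rintegral_mono => //; first exact: Lloc1_cst.
  move=> z z01; have zr : r <= `|v z - u z|.
    by rewrite leNgt; apply/negP => zr; apply: H; exists z.
  apply: (@le_trans _ _ ((v z - u z) ^+ 2)); last by rewrite lerDl sqr_ge0.
  by rewrite -[leRHS](real_normK (num_real _)) lerXn2r// nnegrE ltW.
have [Lw Pw] := primitiveB (H1_primitive v) (H1_primitive u).
have H a b : a \in `[0, 1] -> b \in `[0, 1] -> a <= b ->
    `|(v b - u b) - (v a - u a)| <= r.
  rewrite !in_itv/= => /andP[a0 a1] /andP[b0 b1] ab.
  rewrite -(Pw _ _ ab); apply: le_trans (dist_wderiv_le r0 (ltW vur)).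
  rewrite dist_wderivE.
  apply: le_trans (Rintegral_itvcc_subset (Lloc1_dist_wderiv v u) _ a0 b1) => //.
  by apply: le_normr_Rintegral_itvcc => //; exact: Lloc1_dist_wderiv.
have : `|(v x - u x) - (v z - u z)| <= r.
  have [zx|/ltW xz] := leP z x; first exact: H.
  by rewrite distrC; exact: H.
have := ler_normD (v x - u x - (v z - u z)) (v z - u z).
by rewrite subrK; lra.
Qed.

Lemma data_close u r : 0 < r -> exists2 d : R, 0 < d &
  forall v, H1norm (v \- u) < d -> [/\ dist_edens v u <= r, dist_wderiv v u <= r
    & forall x, x \in `[0, 1] -> `|v x - u x| <= r].
Proof.
move=> r0; have h := total_energy1_gt0 u; have h0 := total_energy_ge0 u.
(* Fixed before v, so that the term [t * total_energy u] of [dist_edens_le] is at most r/2. *)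
pose t := r / (2 * (1 + total_energy u)).
have t0 : 0 < t by rewrite divr_gt0// mulr_gt0.
have t1 : 0 < 1 + t^-1 by rewrite ltr_wpDr ?invr_ge0 ?ltW.
(* The bound 1 gives d^2 <= d; r/2 absorbs the factor 2 of [sup_dist]; the last term makes
   [(1 + t^-1) * d] at most r/2. *)
pose d := Num.min (Num.min 1 (r / 2)) (r / (2 * (1 + t^-1))).
have d0 : 0 < d by rewrite !lt_min ltr01 !divr_gt0// mulr_gt0.
have : d <= d by []; rewrite {2}/d !le_min => /andP[/andP[d1 d2] d3].
exists d => // v /(dist_sqr_lt d0) vud.
have vur : dist_sqr v u < (r / 2) ^+ 2.
  by rewrite (lt_le_trans vud)// lerXn2r// nnegrE ltW// divr_gt0.
split.
- apply: (le_trans (dist_edens_le v u t0)).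
  have th : t * total_energy u <= r / 2.
    have -> : r / 2 = t * (1 + total_energy u).
      by rewrite /t; move: (total_energy u) h => h' h'0; field; rewrite gt_eqF.
    by rewrite ler_pM2l// lerDr.
  have td : (1 + t^-1) * dist_sqr v u <= r / 2.
    have -> : r / 2 = (1 + t^-1) * (r / (2 * (1 + t^-1))).
      by move: (1 + t^-1) t1 => q q0; field; rewrite gt_eqF.
    rewrite ler_pM2l//; apply: (le_trans (ltW vud)); apply: le_trans d3.
    by rewrite expr2 ler_piMr// ltW.
  by move: th td; move: (t * _) (_ * dist_sqr v u) => a b; lra.
- apply: (le_trans (dist_wderiv_le _ (ltW vur))); first by rewrite divr_gt0.
  by lra.
- move=> x /(sup_dist _ vur); rewrite divr_gt0// => /(_ isT) h1.
  by apply: (le_trans h1); lra.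
Qed.

(* Compare with a continuous K close to [k o y_u] in L^1: the error
   [k_v o y_v - K o arclen_u o y_v] is estimated in the Eulerian variable. *)
Lemma composition_close u (k : R -> R) e : measurable_fun setT k ->
  (forall x, `|k x| <= 1) -> 0 < e ->
  exists2 d : R, 0 < d & forall v (k' : R -> R), measurable_fun setT k' ->
    (forall x, `|k' x| <= 1) -> dist_edens v u <= d ->
    \int[mu]_(x in `[0, 1]) `|k' x * (1 + edens v x) - k x * (1 + edens u x)| <= d ->
    \int[mu]_(s in `[0, 1]) `|k' (lag_y v s) - k (lag_y u s)| <= e.
Proof.
move=> mk k1 e0; have h := total_energy1_gt0 u.
have Lk w (q : R -> R) : measurable_fun setT q -> (forall x, `|q x| <= 1) ->
    Lloc 1%:E (fun s => q (lag_y w s)).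
  move=> mq q1; apply: (@Lloc1_bounded _ _ 1) => [|s]; last exact: q1.
  exact: (measurableT_comp mq (measurable_lag_y w)).
have Lq w (q : R -> R) : measurable_fun setT q -> (forall x, `|q x| <= 1) ->
    Lloc 1%:E (fun x => q x * (1 + edens w x)).
  move=> mq q1; apply: Lloc1M => //; first by move=> a b; exists 1.
  by apply: (Lloc1D (Lloc1_cst 1)); exact: Lloc1_edens.
(* The approximation error enters once in [T2], once in [T3] and 1 + h times in [T1]: altogether (3
   + h) e1 = e/2. *)
pose e1 := e / (2 * (3 + total_energy u)).
have e10 : 0 < e1 by rewrite divr_gt0// mulr_gt0//; lra.
have [K cK Ke1] := approximation_continuous 0 1 e10 (Lk u k mk k1).
have [B0 KB0] := continuous_bounded_itvcc 0 1 cK.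
pose B := `|B0|; have B00 : 0 <= B by exact: normr_ge0.
have KB x : x \in `[0, 1] -> `|K x| <= B.
  by move=> /KB0/le_trans; apply; exact: ler_norm.
have [m m0 Km] := uniform_modulus 0 1 cK e10.
(* By [arclen_dist1] the argument of K moves by at most 2d < m; the remaining error d + B d in [T1]
   is at most e/2. *)
pose d := Num.min (m / 4) (e / (2 * (1 + B))).
have d0 : 0 < d by rewrite lt_min !divr_gt0// mulr_gt0//; lra.
have : d <= d by []; rewrite {2}/d le_min => /andP[dm dB].
exists d => // v k' mk' k'1 vud kd.
have ca w : continuous (arclen w) := primitive_continuous (primitive_arclen w).
have cy w : continuous (lag_y w) := primitive_continuous (primitive_lag_y w).
have cKa : continuous (K \o arclen u).
  by move=> x; apply: continuous_comp; [exact: ca|exact: cK].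
have mKa : measurable_fun setT (K \o arclen u) by exact: continuous_measurable_fun.
have cKay : continuous (fun s => K (arclen u (lag_y v s))).
  by move=> s; apply: (@continuous_comp _ _ _ (lag_y v) (K \o arclen u)); [exact: cy|exact: cKa].
have LKay := Lloc1_continuous cKay; have LK := Lloc1_continuous cK.
have a01 w x : x \in `[0, 1] -> arclen w x \in `[0, 1].
  have E0 : arclen w 0 = 0 by rewrite -{1}(lag_y0 w) arclen_lag_y.
  have E1 : arclen w 1 = 1 by rewrite -{1}(lag_y1 w) arclen_lag_y.
  have [_ _ [_ homa] _] := substitution_lag_y w.
  rewrite !in_itv/= => /andP[x0 x1].
  by apply/andP; split; [rewrite -E0|rewrite -E1]; exact: homa.
have y01 w s : s \in `[0, 1] -> lag_y w s \in `[0, 1].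
  by rewrite !in_itv/=; exact: lag_y_itv01.
have LN (f g : R -> R) : Lloc 1%:E f -> Lloc 1%:E g -> Lloc 1%:E (fun x => `|f x - g x|).
  by move=> Lf Lg; apply: Lloc1_norm; exact: Lloc1B.
pose T1 := \int[mu]_(s in `[0, 1]) `|k' (lag_y v s) - K (arclen u (lag_y v s))|.
pose T2 := \int[mu]_(s in `[0, 1]) `|K (arclen u (lag_y v s)) - K s|.
pose T3 := \int[mu]_(s in `[0, 1]) `|k (lag_y u s) - K s|.
have T123 : \int[mu]_(s in `[0, 1]) `|k' (lag_y v s) - k (lag_y u s)| <= T1 + T2 + T3.
  have L1 := LN _ _ (Lk v k' mk' k'1) LKay; have L2 := LN _ _ LKay LK.
  have L3 := LN _ _ (Lk u k mk k1) LK.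
  rewrite /T1 /T2 /T3 -(RintegralD_itvcc _ _ L1 L2) -(RintegralD_itvcc _ _ (Lloc1D L1 L2) L3).
  apply: Rintegral_mono; first exact: LN (Lk v k' mk' k'1) (Lk u k mk k1).
    exact: Lloc1D (Lloc1D L1 L2) L3.
  move=> s _ /=.
  move: (k' (lag_y v s)) (k (lag_y u s)) (K (arclen u (lag_y v s))) (K s) => a b c c'.
  have -> : a - b = (a - c) + (c - c') - (b - c') by ring.
  by apply: (le_trans (ler_normB _ _)); rewrite lerD2r ler_normD.
have T2e : T2 <= e1.
  apply: (@le_trans _ _ (\int[mu]_(s in `[0, 1]) e1)); last first.
    by rewrite Rintegral_cst_itvcc// subr0 mulr1.
  apply: Rintegral_mono; [exact: LN|exact: Lloc1_cst|move=> s s01].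
  apply/ltW/Km => //; rewrite in_itv/= in s01.
  by apply: (le_lt_trans (arclen_dist1 v u s01)); lra.
have T3e : T3 <= e1 by exact: ltW.
have Lkv := Lq v k' mk' k'1; have Lku := Lq u k mk k1.
have LKav : Lloc 1%:E (fun x => K (arclen u x) * (1 + edens v x)).
  by apply: (Lloc1_continuousM cKa); apply: (Lloc1D (Lloc1_cst 1)); exact: Lloc1_edens.
have LKau : Lloc 1%:E (fun x => K (arclen u x) * (1 + edens u x)).
  by apply: (Lloc1_continuousM cKa); apply: (Lloc1D (Lloc1_cst 1)); exact: Lloc1_edens.
have subst w (q : R -> R) : measurable_fun setT q ->
    \int[mu]_(s in `[0, 1]) `|q (lag_y w s) - K (arclen u (lag_y w s))| =
    \int[mu]_(x in `[0, 1])
      ((1 + total_energy w)^-1 * `|q x * (1 + edens w x) - K (arclen u x) * (1 + edens w x)|).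
  move=> mq.
  rewrite (@ge0_Rintegral_substitution _ _ _ _ (fun x => `|q x - K (arclen u x)|)
    0 1 (substitution_lag_y w))//; last first.
    by apply: measurableT_comp => //; exact: measurable_funB.
  rewrite lag_y0 lag_y1; apply: eq_Rintegral => x _.
  rewrite /arclen_density mulrCA; congr (_ * _).
  by rewrite -mulrBl normrM (gtr0_norm (edens1_gt0 w x)).
(* [arclen u] undoes [lag_y u], so [T3] carries over to the Eulerian variable: K o arclen_u
   approximates k there with weight 1 + e_u. *)
have T3E : \int[mu]_(x in `[0, 1]) `|k x * (1 + edens u x) - K (arclen u x) * (1 + edens u x)|
    <= (1 + total_energy u) * e1.
  have T3K : T3 = \int[mu]_(s in `[0, 1]) `|k (lag_y u s) - K (arclen u (lag_y u s))|.
    by apply: eq_Rintegral => s _; rewrite (arclen_lag_y u s).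
  move: T3e; rewrite T3K (subst u k mk) (RintegralZl_itvcc _ _ _ (LN _ _ Lku LKau)).
  by rewrite ler_pdivrMl// mulrC.
(* After substitution the factor 1/(1 + h_v) <= 1 is dropped. Passing from k_v (1 + e_v) to k (1 +
   e_u) costs d by hypothesis, and changing the weight of K costs B times [dist_edens v u]. *)
have T1e : T1 <= d + (1 + total_energy u) * e1 + B * d.
  rewrite /T1 (subst v k' mk') (RintegralZl_itvcc _ _ _ (LN _ _ Lkv LKav)).
  set I := \int[mu]_(x in _) _.
  have I0 : 0 <= I by apply: Rintegral_ge0 => x _.
  apply: (@le_trans _ _ I).
    by rewrite ler_piMl// invf_le1 ?total_energy1_gt0// lerDl total_energy_ge0.
  have LB : Lloc 1%:E (fun x => B * `|edens v x - edens u x|).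
    exact: Lloc1Z (Lloc1_dist_edens v u).
  have L1 := LN _ _ Lkv Lku; have L2 := LN _ _ Lku LKau.
  apply: (@le_trans _ _ (\int[mu]_(x in `[0, 1]) (
     `|k' x * (1 + edens v x) - k x * (1 + edens u x)| +
     `|k x * (1 + edens u x) - K (arclen u x) * (1 + edens u x)| +
     B * `|edens v x - edens u x|))).
    apply: Rintegral_mono; [exact: LN|exact: Lloc1D (Lloc1D L1 L2) LB|move=> x x01].
    have := KB _ (a01 u x x01).
    move: (k' x) (k x) (K _) (edens v x) (edens u x) => a b c ev eu cB.
    have -> : a * (1 + ev) - c * (1 + ev) =
      (a * (1 + ev) - b * (1 + eu)) + (b * (1 + eu) - c * (1 + eu)) - c * (ev - eu).
      by ring.
    apply: (le_trans (ler_normB _ _)); apply: lerD; first exact: ler_normD.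
    by rewrite normrM ler_wpM2r.
  rewrite (RintegralD_itvcc _ _ (Lloc1D L1 L2) LB) (RintegralD_itvcc _ _ L1 L2).
  rewrite (RintegralZl_itvcc _ _ _ (Lloc1_dist_edens v u)) -dist_edensE.
  by apply: lerD; [exact: lerD|exact: ler_wpM2l].
apply: (le_trans T123).
have E1 : e1 * (3 + total_energy u) = e / 2.
  rewrite /e1; move: (total_energy u) h => q q0; field; rewrite gt_eqF//; lra.
have E2 : d * (1 + B) <= e / 2.
  have -> : e / 2 = e / (2 * (1 + B)) * (1 + B) by field; rewrite gt_eqF//; lra.
  by rewrite ler_wpM2r//; lra.
clear -T1e T2e T3e E1 E2; lra.
Qed.

End convergence.

(** * Continuity of the embedding *)

Section continuity.
Context {R : realType}.
Local Notation mu := (@lebesgue_measure R).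
Implicit Types (u v : H1per R) (e s r : R).

(** (1 + h_v) a - (1 + h_u) b = (h_v - h_u) a + (1 + h_u) (a - b), with |a| <= 1. *)
Lemma scaled_dist_le v u (k' k : R -> R) e :
  measurable_fun setT k' -> measurable_fun setT k ->
  (forall x, `|k' x| <= 1) -> (forall x, `|k x| <= 1) ->
  \int[mu]_(s in `[0, 1]) `|k' (lag_y v s) - k (lag_y u s)| <= e ->
  \int[mu]_(s in `[0, 1]) `|(1 + total_energy v) * k' (lag_y v s)
                           - (1 + total_energy u) * k (lag_y u s)|
  <= dist_edens v u + (1 + total_energy u) * e.
Proof.
move=> mk' mk k'1 k1 ke.
have Lk w (q : R -> R) : measurable_fun setT q -> (forall x, `|q x| <= 1) ->
    Lloc 1%:E (fun s => q (lag_y w s)).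
  move=> mq q1; apply: (@Lloc1_bounded _ _ 1) => [|s]; last exact: q1.
  exact: (measurableT_comp mq (measurable_lag_y w)).
have Lk' := Lk v k' mk' k'1; have {}Lk := Lk u k mk k1.
have Ld := Lloc1_norm (Lloc1B Lk' Lk).
have hvu := total_energy_dist v u; have hu := total_energy1_gt0 u.
apply: (@le_trans _ _ (\int[mu]_(s in `[0, 1]) (dist_edens v u
    + (1 + total_energy u) * `|k' (lag_y v s) - k (lag_y u s)|))).
  apply: Rintegral_mono.
  - by apply/Lloc1_norm/Lloc1B; exact: Lloc1Z.
  - by apply: Lloc1D; [exact: Lloc1_cst|exact: Lloc1Z].
  - move=> s _; move: (k'1 (lag_y v s)).
    move: (k' (lag_y v s)) (k (lag_y u s)) hvu hu => a b.
    move: (dist_edens v u) (total_energy v) (total_energy u) => d hv h hvh h0 a1.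
    have -> : (1 + hv) * a - (1 + h) * b = (hv - h) * a + (1 + h) * (a - b) by ring.
    apply: (le_trans (ler_normD _ _)); rewrite !normrM (gtr0_norm h0) lerD2r.
    by rewrite -[leRHS]mulr1 ler_pM.
rewrite (RintegralD_itvcc _ _ (Lloc1_cst _) (Lloc1Z _ Ld)) (RintegralZl_itvcc _ _ _ Ld).
by rewrite Rintegral_cst_itvcc// subr0 mulr1 lerD2l ler_pM2l.
Qed.

Lemma dD_embed_continuous u e : 0 < e -> exists2 d : R, 0 < d &
  forall v, H1norm (v \- u) < d -> (dD (embed v) (embed u) < e%:E)%E.
Proof.
move=> e0; have h := total_energy1_gt0 u.
have e10 : 0 < e / (16 * (1 + total_energy u)) by rewrite divr_gt0// mulr_gt0.
have slope1 (w : H1per R) x : `|slope w x| <= 1 by rewrite gtr0_norm ?slope_gt0 ?slope_le1.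
have [d1 d10 H1] := composition_close u (measurable_slope u) (slope1 u) e10.
have [d2 d20 H2] := composition_close u (measurable_slopeU u) (slopeU_le1 u) e10.
have e80 : 0 < e / 8 by rewrite divr_gt0.
have [m m0 um] := uniform_modulus 0 1 (@H1_continuous _ u) e80.
(* Since y moves by at most 2r, m/4 keeps it within the modulus of u. The final sum is at most 7r +
   5e/16, and r <= e/32 leaves it below e. *)
pose r := Num.min (Num.min d1 d2) (Num.min (m / 4) (e / 32)).
have r0 : 0 < r by rewrite !lt_min d10 d20 !divr_gt0.
have : r <= r by []; rewrite {2}/r !le_min => /andP[/andP[rd1 rd2] /andP[rm re]].
have [d d0 Hd] := data_close u r0; exists d => // v /Hd[vu1 vu2 vu3].
have y01 (w : H1per R) s : s \in `[0, 1] -> lag_y w s \in `[0, 1].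
  by rewrite !in_itv/=; exact: lag_y_itv01.
have yM s : s \in `[0, 1] -> `|lag_y v s - lag_y u s| <= 2 * r.
  by rewrite in_itv/= => /(lag_y_dist v u) /le_trans; apply; rewrite ler_pM2l.
have UM s : s \in `[0, 1] -> `|v (lag_y v s) - u (lag_y u s)| <= r + e / 8.
  move=> s01; have := vu3 _ (y01 v s s01); have := um _ (lag_y v s) (y01 u s s01).
  have ym := yM s s01; move/(_ (le_lt_trans ym _)) => h1 h2.
  have -> : v (lag_y v s) - u (lag_y u s) =
    (v (lag_y v s) - u (lag_y v s)) + (u (lag_y v s) - u (lag_y u s)).
    by rewrite addrA subrK.
  apply: (le_trans (ler_normD _ _)); apply: lerD => //; apply/ltW/h1; lra.
have r20 : 0 <= 2 * r by rewrite mulr_ge0// ltW.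
have re80 : 0 <= r + e / 8 by rewrite addr_ge0// ltW.
apply: (le_lt_trans (dD_embed_le r20 re80 yM UM)).
have D1 : \int[mu]_(s in `[0, 1]) `|dslope v u s| <= dist_edens v u + e / 16.
  have -> : e / 16 = (1 + total_energy u) * (e / (16 * (1 + total_energy u))).
    by move: (1 + total_energy u) h => q q0; field; rewrite gt_eqF.
  apply: scaled_dist_le; [exact: measurable_slope..|exact: slope1|exact: slope1|].
  apply: H1; [exact: measurable_slope|exact: slope1|exact: le_trans rd1|].
  (* [slope] times 1 + e is 1 for both u and v, so the weighted difference vanishes. *)
  rewrite (@eq_Rintegral _ _ _ mu `[0, 1]%classic (cst 0)).
    by rewrite Rintegral_cst// mul0r ltW.
  move=> x _; have := edens1_gt0 v x; have := edens1_gt0 u x; rewrite /slope.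
  by move=> /lt0r_neq0/mulVf-> /lt0r_neq0/mulVf->; rewrite subrr normr0.
have D2 : \int[mu]_(s in `[0, 1]) `|dslopeU v u s| <= dist_edens v u + e / 16.
  have -> : e / 16 = (1 + total_energy u) * (e / (16 * (1 + total_energy u))).
    by move: (1 + total_energy u) h => q q0; field; rewrite gt_eqF.
  apply: scaled_dist_le; [exact: measurable_slopeU..|exact: slopeU_le1|exact: slopeU_le1|].
  apply: H2; [exact: measurable_slopeU|exact: slopeU_le1|exact: le_trans rd2|].
  apply: le_trans (le_trans vu2 rd2); rewrite dist_wderivE.
  (* [slopeU] times 1 + e is the weak derivative, so the weighted difference is that of u_x and
     v_x. *)
  rewrite (@eq_Rintegral _ _ _ mu `[0, 1]%classic (fun x => `|wderiv v x - wderiv u x|))//.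
  by move=> x _; rewrite /slopeU !divfK// lt0r_neq0// edens1_gt0.
rewrite lte_fin; have hvu := total_energy_dist v u.
move: D1 D2 hvu vu1; move: (dist_edens v u) (\int[mu]_(s in _) `|dslope v u s|)
  (\int[mu]_(s in _) `|dslopeU v u s|) `|total_energy v - total_energy u| => k i1 i2 hh.
by move=> D1 D2 hvu vu1; clear -D1 D2 hvu vu1 re e0; lra.
Qed.

End continuity.

Theorem proposition6p1 (R : realType) :
  [/\ forall u : H1per R, inD (embed u).1 (embed u).2,
      forall (u : H1per R) (eps : R), 0 < eps ->
        exists2 delta : R, 0 < delta &
          forall v : H1per R, H1norm (v \- u) < delta ->
            (dD (embed v) (embed u) < eps%:E)%E
    & forall (un : nat -> H1per R) (u : H1per R),
        H1norm (un n \- u) @[n --> \oo] --> 0 ->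
        dD (embed (un n)) (embed u) @[n --> \oo] --> 0%E].
Proof.
split; [exact: inD_embed|exact: dD_embed_continuous|].
move=> un u unu.
have near_lt (e : R) : 0 < e ->
    \forall n \near \oo, (0 <= dD (embed (un n)) (embed u) < e%:E)%E.
  move=> e0; have [d d0 H] := dD_embed_continuous u e0.
  move/cvgrPdist_lt : unu => /(_ _ d0); apply: filterS => n.
  rewrite sub0r normrN => und; rewrite dF_ge0/=; apply: H.
  exact: le_lt_trans (ler_norm _) und.
(* The distance is an extended real: it is first shown to be eventually finite, here below 1, and
   then its real part converges. *)
apply/fine_cvgP; split.
  by apply: filterS (near_lt 1 ltr01) => n /andP[p q]; rewrite ge0_fin_numE// (lt_trans q) ?ltry.
apply/cvgrPdist_lt => e e0; apply: filterS (near_lt _ e0) => n /andP[p q].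
rewrite sub0r normrN /= ger0_norm ?fine_ge0// -lte_fin fineK//.
by rewrite ge0_fin_numE// (lt_trans q) ?ltry.
Qed.
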